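(* Let $L$ be a nondegenerate homogeneous linear pencil in $g$ variables and let $\tilde L$ be an $\ell'\times\ell$ minimal dimensional defining pencil for $\mathcal B_L$. If $f:\mathcal B_L\to\mathcal M_{\ell',\ell}$ is a pencil ball map with $f(0)=0$, then $$f(x)=U\tilde L(x)V^*$$ for some unitaries $U\in\mathbb C^{\ell'\times\ell'}$ and $V\in\mathbb C^{\ell\times\ell}$.
   Context: Pencils. A $d'\times d$ homogeneous linear pencil in $g$ variables is $L(x)=\sum_{j=1}^g A_jx_j$ with $A_j\in\mathbb C^{d'\times d}$. For $X=(X_1,\dots,X_g)\in(\mathbb C^{n\times n})^g$ put $L(X)=\sum_j A_j\otimes X_j$; $\|\cdot\|$ is the operator norm. $L$ is nondegenerate if for all $n$ and all $X\in(\mathbb C^{n\times n})^g$, $L(X)=0$ implies $X=0$. The pencil ball is $\mathcal B_L=(\mathcal B_L(n))_{n\in\mathbb N}$ with $\mathcal B_L(n)=\{X\in(\mathbb C^{n\times n})^g:\|L(X)\|<1\}$, and its boundary is $\partial\mathcal B_L=(\partial\mathcal B_L(n))_{n}$ with $\partial\mathcal B_L(n)=\{X:\|L(X)\|=1\}$. A nondegenerate $p'\times p$ homogeneous linear pencil $\tilde L$ is a minimal dimensional defining pencil for a ball if every nondegenerate $d'\times d$ homogeneous linear pencil $L$ with $\mathcal B_L=\mathcal B_{\tilde L}$ satisfies $p'p\le d'd$; it is a minimal dimensional defining pencil for $\mathcal B_L$ if moreover $\mathcal B_{\tilde L}=\mathcal B_L$. Analytic maps. $\mathcal M_{\ell',\ell}=((\mathbb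 C^{n\times n})^{\ell'\times\ell})_{n\in\mathbb N}$. Let $\langle x\rangle$ be the set of words in the noncommuting variables $x_1,\dots,x_g$ (including the empty word). A formal power series $f=\sum_{m\ge0}\sum_{|w|=m}f_ww$ with $f_w\in\mathbb C^{\ell'\times\ell}$ is evaluated at $X\in(\mathbb C^{n\times n})^g$ by $f(X)=\sum_{m=0}^\infty\sum_{|w|=m}f_w\otimes w(X)$ (summed in this order), where $w(X)=X_{j_1}\cdots X_{j_k}$ for $w=x_{j_1}\cdots x_{j_k}$. It is analytic on $\mathcal B_L$, written $f:\mathcal B_L\to\mathcal M_{\ell',\ell}$, if the series converges for all $n$ and all $X\in\mathcal B_L(n)$; it is contraction-valued if $\|f(X)\|\le1$ for all $X\in\mathcal B_L$. If $f$ is contraction-valued and $X\in\partial\mathcal B_L(n)$, the bounded analytic function $z\mapsto f(zX)$ on the unit disc has boundary values $f(\exp(it)X)$ for almost every $t$ (Fatou). A pencil ball map is a contraction-valued analytic $f$ with $\|f(\exp(it)X)\|=1$ for a.e. $t$, for every $n$ and every $X\in\partial\mathcal B_L(n)$. *)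

(* Defs.v *)
From mathcomp Require Import all_boot all_order all_algebra.
From mathcomp Require Import complex.
From mathcomp Require mxtens.
From mathcomp Require Import all_classical all_reals all_analysis.

Set Implicit Arguments.
Unset Strict Implicit.
Unset Printing Implicit Defensive.

Import Order.TTheory GRing.Theory Num.Theory.
Import numFieldNormedType.Exports.
Import mxtens(tensmx).

Local Open Scope classical_set_scope.
Local Open Scope ring_scope.

(* [R[i]] carries no topology of its own; typed as a bundled
   [numClosedFieldType] it gets the norm topology of a [numFieldType], and
   matrices over it the product topology. *)
Definition Cplx (R : realType) : numClosedFieldType := R[i].

Section OperatorNorm.
Variable R : realType.
Local Notation C := (Cplx R).

Definition l2norm n (v : 'cV[C]_n) : R :=
  Num.sqrt (\sum_i Normc.normc (v i 0) ^+ 2).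

Definition opnorm m n (A : 'M[C]_(m, n)) : R :=
  sup [set l2norm (A *m v) | v in [set v : 'cV[C]_n | l2norm v <= 1]].

End OperatorNorm.

(* [L : pencil R g d' d] stands for the coefficients A_1, ..., A_g. *)
Definition pencil (R : realType) (g d' d : nat) := 'I_g -> 'M[Cplx R]_(d', d).

Definition mxpoint (R : realType) (g n : nat) := {ffun 'I_g -> 'M[Cplx R]_n}.

(* A formal power series is the family of its coefficients f_w, where the word
   x_{j_1} ... x_{j_k} is the sequence [:: j_1; ...; j_k]. *)
Definition fps (R : realType) (g l' l : nat) :=
  seq 'I_g -> 'M[Cplx R]_(l', l).

Section Pencils.
Variables (R : realType) (g : nat).
Local Notation C := (Cplx R).
Local Notation pencil := (pencil R g).
Local Notation mxpoint := (mxpoint R g).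

Definition pencil_eval d' d (L : pencil d' d) n (X : mxpoint n) :
  'M[C]_(d' * n, d * n) := \sum_j tensmx (L j) (X j).

Definition nondegenerate_pencil d' d (L : pencil d' d) :=
  forall n (X : mxpoint n), pencil_eval L X = 0 -> X = 0.

Definition pencil_ball d' d (L : pencil d' d) n : set (mxpoint n) :=
  [set X | opnorm (pencil_eval L X) < 1].

Definition pencil_sphere d' d (L : pencil d' d) n : set (mxpoint n) :=
  [set X | opnorm (pencil_eval L X) = 1].

Definition same_ball d' d (L : pencil d' d) e' e (M : pencil e' e) :=
  forall n, @pencil_ball _ _ L n = @pencil_ball _ _ M n.

Definition minimal_defining_pencil p' p (Lt : pencil p' p) :=
  nondegenerate_pencil Lt /\
  forall d' d (L : pencil d' d),
    nondegenerate_pencil L -> same_ball L Lt -> (p' * p <= d' * d)%N.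

Definition minimal_defining_pencil_for d' d (L : pencil d' d)
    p' p (Lt : pencil p' p) :=
  minimal_defining_pencil Lt /\ same_ball Lt L.

End Pencils.

Section PowerSeries.
Variables (R : realType) (g l' l : nat).
Local Notation C := (Cplx R).
Local Notation pencil := (pencil R g).
Local Notation mxpoint := (mxpoint R g).
Local Notation fps := (fps R g).

Definition word_eval n (X : mxpoint n) (w : seq 'I_g) : 'M[C]_n :=
  \prod_(j <- w) X j.

Definition fps_homog (f : fps l' l) n (X : mxpoint n) (m : nat) :
  'M[C]_(l' * n, l * n) :=
  \sum_(w : m.-tuple 'I_g) tensmx (f w) (word_eval X w).

Definition fps_eval (f : fps l' l) n (X : mxpoint n) : 'M[C]_(l' * n, l * n) :=
  limn (series (fps_homog f X)).

Definition analytic_on d' d (L : pencil d' d) (f : fps l' l) :=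
  forall n (X : mxpoint n), pencil_ball L X -> cvgn (series (fps_homog f X)).

Definition contraction_valued d' d (L : pencil d' d) (f : fps l' l) :=
  forall n (X : mxpoint n), pencil_ball L X -> opnorm (fps_eval f X) <= 1.

(* The point r exp(it). *)
Definition polar (r t : R) : C := Complex (r * cos t) (r * sin t).

(* [Y] is the boundary value f(exp(it)X): the radial limit of f(r exp(it)X) as
   r tends to 1 from below. *)
Definition boundary_value (f : fps l' l) n (X : mxpoint n) (t : R)
    (Y : 'M[C]_(l' * n, l * n)) :=
  fps_eval f (polar r t *: X) @[r --> (1 : R)^'-] --> Y.

Definition pencil_ball_map d' d (L : pencil d' d) (f : fps l' l) :=
  [/\ analytic_on L f, contraction_valued L f &
      forall n (X : mxpoint n), pencil_sphere L X ->
        {ae (@lebesgue_measure R), forall t : R,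
          exists2 Y, boundary_value f X t Y & opnorm Y = 1}].

(* A homogeneous linear pencil, seen as a formal power series. *)
Definition pencil_fps (L : pencil l' l) : fps l' l :=
  fun w => if w is [:: j] then L j else 0.

End PowerSeries.

(* Main.v *)
(* The argument is linear-algebraic. Evaluating [f] at nilpotent points isolates
   its coefficients: at the points [X (x) E_12] it shows that the linear part [B]
   of [f] satisfies |B(X)| = |Lt(X)| for all [X], and at longer nilpotent points
   that every pencil [B, c F], with [F] made of the coefficients of the words
   [i :: w] for a fixed nonempty [w], defines the same ball as [B].

   By semidefinite duality, |B(X)| <= |A(X)| for all [X] forces
   [B_j = sum_k W_k^* A_j V_k] with [sum_k W_k^* W_k = 1] and
   [sum_k V_k^* V_k = 1]. Minimality makes such compressions rigid. If [A] is
   itself recovered from [B] in the same way, the composed compression fixes [A]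
   and preserves the spaces of vectors at which A(X) attains its norm; it hence
   has invariant densities supported there, and by minimality these can be taken
   invertible. Testing against them turns the inequalities into equalities, so
   that every pair [(V_k, W_k)] intertwines [A] and [B], as well as their
   adjoints. Applied to [Lt] and [B], an intertwiner of maximal rank is unitary;
   applied to [B] and [B, c F], one of the intertwining relations reads
   [F^* = 0]. *)
Require Import Defs.
From mathcomp Require Import all_boot all_order all_algebra.
From mathcomp Require Import complex ring lra.
From mathcomp Require mxtens.
From mathcomp Require Import all_classical all_reals all_analysis.

Set Implicit Arguments.
Unset Strict Implicit.
Unset Printing Implicit Defensive.

Import Order.TTheory GRing.Theory Num.Theory.
Import numFieldNormedType.Exports.
Import mxtens(tensmx, mxtens_index, mxtens_unindex, mxtens_indexK, mxtens_unindexK).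

Local Open Scope ring_scope.
Local Open Scope sesquilinear_scope.

(** * Adjoints and the Hilbert-Schmidt norm *)

Section Adjoint.
Variable C : numClosedFieldType.

(** Domination of one pencil by another at all sizes says that the map between their coefficients is
    completely contractive, and the sums over k are the Haagerup-Paulsen-Wittstock form of such a
    map. That form has many terms, whereas the theorem asks for one pair of unitaries. Two features
    of minimality shape the way between them. It bounds the product of the two dimensions, so the
    supports on the domain and the codomain side must be cut down together; invariant densities are
    therefore chosen in pairs, with maximal sum of ranks. And it does not exclude direct sums: a
    single pair (V_k, W_k) may vanish on a summand, so the unitaries are reached by adding mutually
    orthogonal polar parts. Nilpotent points enter because the series is a finite sum there, and a
    boundary value is only ever taken of a linear map. Up to the duality everything is algebra over
    an arbitrary [numClosedFieldType], with eigenvectors in place of compactness. *)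

Lemma adjmxM m n p (A : 'M[C]_(m, n)) (B : 'M[C]_(n, p)) :
  (A *m B)^t* = B^t* *m A^t*.
Proof. by rewrite trmx_mul map_mxM. Qed.

Lemma adjmxD m n (A B : 'M[C]_(m, n)) : (A + B)^t* = A^t* + B^t*.
Proof. by rewrite linearD /= map_mxD. Qed.

Lemma adjmxN m n (A : 'M[C]_(m, n)) : (- A)^t* = - A^t*.
Proof. by rewrite linearN /= map_mxN. Qed.

Lemma adjmxZ m n c (A : 'M[C]_(m, n)) : (c *: A)^t* = c^* *: A^t*.
Proof. by rewrite linearZ /= map_mxZ. Qed.

Lemma adjmx0 m n : (0 : 'M[C]_(m, n))^t* = 0.
Proof. by rewrite trmx0 map_mx0. Qed.

Lemma adjmx1 n : (1%:M : 'M[C]_n)^t* = 1%:M.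
Proof. by rewrite trmx1 map_mx1. Qed.

Lemma adjmx_sum m n (I : finType) (F : I -> 'M[C]_(m, n)) :
  (\sum_i F i)^t* = \sum_i (F i)^t*.
Proof. by rewrite raddf_sum /= raddf_sum. Qed.

Lemma mxtrace_adj n (A : 'M[C]_n) : \tr (A^t*) = (\tr A)^*.
Proof. by rewrite /mxtrace rmorph_sum; apply: eq_bigr => i _; rewrite !mxE. Qed.

Definition hsdot m n (u v : 'M[C]_(m, n)) : C := \tr (u^t* *m v).
(** The square of the Hilbert-Schmidt norm: no root is taken, and the gains [c] below are
    accordingly squares of operator norms. *)
Definition hsnorm m n (v : 'M[C]_(m, n)) : C := hsdot v v.

Lemma hsdotE m n (u v : 'M[C]_(m, n)) :
  hsdot u v = \sum_i \sum_j (u i j)^* * v i j.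
Proof.
rewrite /hsdot /mxtrace exchange_big; apply: eq_bigr => j _ /=.
by rewrite !mxE; apply: eq_bigr => i _; rewrite !mxE.
Qed.

Lemma hsnormE m n (v : 'M[C]_(m, n)) :
  hsnorm v = \sum_i \sum_j `|v i j| ^+ 2.
Proof.
rewrite /hsnorm hsdotE; apply: eq_bigr => i _; apply: eq_bigr => j _.
by rewrite normCKC.
Qed.

Lemma hsnorm_ge0 m n (v : 'M[C]_(m, n)) : 0 <= hsnorm v.
Proof.
by rewrite hsnormE; do 2!apply: sumr_ge0 => ? _; rewrite exprn_ge0.
Qed.

Lemma hsnorm_eq0 m n (v : 'M[C]_(m, n)) : (hsnorm v == 0) = (v == 0).
Proof.
apply/eqP/eqP => [|->]; last first.
  by rewrite /hsnorm /hsdot mulmx0 mxtrace0.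
rewrite hsnormE => /eqP; rewrite psumr_eq0; last first.
  by move=> i _; apply: sumr_ge0 => j _; rewrite exprn_ge0.
move=> /allP h; apply/matrixP => i j; rewrite mxE.
have := h i (mem_index_enum _); rewrite /= psumr_eq0; last first.
  by move=> k _; rewrite exprn_ge0.
move=> /allP/(_ j (mem_index_enum _)) /=.
by rewrite sqrf_eq0 normr_eq0 => /eqP.
Qed.

Lemma hsnorm0 m n : hsnorm (0 : 'M[C]_(m, n)) = 0.
Proof. by apply/eqP; rewrite hsnorm_eq0. Qed.

Lemma hsnorm_gt0 m n (v : 'M[C]_(m, n)) : (0 < hsnorm v) = (v != 0).
Proof. by rewrite lt_def hsnorm_ge0 hsnorm_eq0 andbT. Qed.

Lemma hsnormZ m n c (v : 'M[C]_(m, n)) : hsnorm (c *: v) = `|c| ^+ 2 * hsnorm v.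
Proof.
by rewrite /hsnorm /hsdot adjmxZ -scalemxAl -scalemxAr !linearZ /= mulrA
   -normCKC.
Qed.

Lemma hsnorm_adj m n (v : 'M[C]_(m, n)) : hsnorm (v^t*) = hsnorm v.
Proof. by rewrite /hsnorm /hsdot trmxCK mxtrace_mulC. Qed.

Lemma hsdotDr m n (u v w : 'M[C]_(m, n)) : hsdot u (v + w) = hsdot u v + hsdot u w.
Proof. by rewrite /hsdot mulmxDr mxtraceD. Qed.

Lemma hsdotNr m n (u v : 'M[C]_(m, n)) : hsdot u (- v) = - hsdot u v.
Proof. by rewrite /hsdot mulmxN linearN. Qed.

Lemma hsdotNl m n (u v : 'M[C]_(m, n)) : hsdot (- u) v = - hsdot u v.
Proof. by rewrite /hsdot adjmxN mulNmx linearN. Qed.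

Lemma hsdot_sumr m n (I : finType) (u : 'M[C]_(m, n)) (F : I -> 'M[C]_(m, n)) :
  hsdot u (\sum_i F i) = \sum_i hsdot u (F i).
Proof. by rewrite /hsdot mulmx_sumr raddf_sum. Qed.

Lemma hsdot_conj m n (u v : 'M[C]_(m, n)) : (hsdot u v)^* = hsdot v u.
Proof. by rewrite /hsdot -mxtrace_adj adjmxM trmxCK. Qed.

Lemma hsdot_mulr m n p (M : 'M[C]_(p, m)) (u : 'M[C]_(p, n)) (v : 'M[C]_(m, n)) :
  hsdot u (M *m v) = hsdot (M^t* *m u) v.
Proof. by rewrite /hsdot adjmxM trmxCK mulmxA. Qed.

Lemma hsdotDl m n (u v w : 'M[C]_(m, n)) : hsdot (v + w) u = hsdot v u + hsdot w u.
Proof. by rewrite /hsdot adjmxD mulmxDl mxtraceD. Qed.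

Lemma hsnormD m n (u v : 'M[C]_(m, n)) :
  hsnorm (u + v) = hsnorm u + hsnorm v + (hsdot u v + hsdot v u).
Proof.
rewrite /hsnorm hsdotDr !hsdotDl [hsdot u v + hsdot v v]addrC addrACA.
by congr (_ + _); rewrite addrC.
Qed.

Lemma hsnormN m n (u : 'M[C]_(m, n)) : hsnorm (- u) = hsnorm u.
Proof. by rewrite -scaleN1r hsnormZ normrN1 expr1n mul1r. Qed.

Lemma hsnorm_isometry m n p (M : 'M[C]_(p, m)) (v : 'M[C]_(m, n)) :
  M^t* *m M = 1%:M -> hsnorm (M *m v) = hsnorm v.
Proof. by move=> hM; rewrite /hsnorm hsdot_mulr mulmxA hM mul1mx. Qed.

(** The column obtained by stacking the [S k] is an isometry; a single [S k] need not be one. *)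
Definition isometries (I : finType) p m (S : I -> 'M[C]_(p, m)) :=
  \sum_k (S k)^t* *m S k = 1%:M.

Lemma isometries_norm (I : finType) p m n (S : I -> 'M[C]_(p, m)) (v : 'M[C]_(m, n)) :
  isometries S -> \sum_k hsnorm (S k *m v) = hsnorm v.
Proof.
move=> hS; transitivity (hsdot v (1%:M *m v)); last by rewrite mul1mx.
rewrite -hS mulmx_suml hsdot_sumr.
by apply: eq_bigr => k _; rewrite -mulmxA [in RHS]hsdot_mulr trmxCK.
Qed.

Lemma isometries_comp (I J : finType) p m n (S : I -> 'M[C]_(p, m))
    (T : J -> 'M[C]_(m, n)) :
  isometries S -> isometries T -> isometries (fun k : I * J => S k.1 *m T k.2).
Proof.
move=> hS hT; rewrite /isometries -hT.
rewrite -(pair_bigA _ (fun i j => (S i *m T j)^t* *m (S i *m T j))) exchange_big /=.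
apply: eq_bigr => j _; rewrite -[in RHS](mulmx1 ((T j)^t*)) -hS mulmx_sumr mulmx_suml.
by apply: eq_bigr => i _; rewrite adjmxM !mulmxA.
Qed.

(* The defect identity behind every rigidity argument below: [u] is the
   compression of the [y k], and the defect measures how far it is from
   reconstructing them. *)
Lemma compression_defect (I : finType) p m n (S : I -> 'M[C]_(p, m))
    (y : I -> 'M[C]_(p, n)) (u : 'M[C]_(m, n)) :
  isometries S -> u = \sum_k (S k)^t* *m y k ->
  \sum_k hsnorm (y k - S k *m u) = \sum_k hsnorm (y k) - hsnorm u.
Proof.
move=> hS hu.
have h1 : \sum_k hsdot (S k *m u) (y k) = hsnorm u.
  rewrite /hsnorm [X in hsdot u X]hu hsdot_sumr; apply: eq_bigr => k _.
  by rewrite hsdot_mulr trmxCK.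
have h2 : \sum_k hsdot (y k) (S k *m u) = hsnorm u.
  rewrite -[RHS]conj_Creal ?ger0_real ?hsnorm_ge0// -h1 rmorph_sum.
  by apply: eq_bigr => k _; exact/esym/hsdot_conj.
transitivity (\sum_k (hsnorm (y k) + hsnorm (S k *m u)
    - (hsdot (y k) (S k *m u) + hsdot (S k *m u) (y k)))).
  by apply: eq_bigr => k _; rewrite hsnormD hsnormN hsdotNr hsdotNl opprD.
rewrite sumrB !big_split /= h1 h2 (isometries_norm _ hS).
by rewrite opprD addrA addrK.
Qed.

Lemma compression_le (I : finType) p m n (S : I -> 'M[C]_(p, m))
    (y : I -> 'M[C]_(p, n)) (u : 'M[C]_(m, n)) :
  isometries S -> u = \sum_k (S k)^t* *m y k ->
  hsnorm u <= \sum_k hsnorm (y k).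
Proof.
move=> hS hu; rewrite -subr_ge0 -(compression_defect hS hu).
by apply: sumr_ge0 => k _; apply: hsnorm_ge0.
Qed.

Lemma compression_eq (I : finType) p m n (S : I -> 'M[C]_(p, m))
    (y : I -> 'M[C]_(p, n)) (u : 'M[C]_(m, n)) :
  isometries S -> u = \sum_k (S k)^t* *m y k ->
  \sum_k hsnorm (y k) <= hsnorm u -> forall k, y k = S k *m u.
Proof.
move=> hS hu; rewrite -subr_le0 -(compression_defect hS hu) => h k.
have : \sum_k hsnorm (y k - S k *m u) == 0.
  by rewrite eq_le h; apply: sumr_ge0 => i _; apply: hsnorm_ge0.
rewrite psumr_eq0 => [/allP/(_ k (mem_index_enum _)) /=|i _]; last exact: hsnorm_ge0.
by rewrite hsnorm_eq0 subr_eq0 => /eqP.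
Qed.

Lemma hsnorm_adj_isom m n p (M : 'M[C]_(p, m)) (v : 'M[C]_(p, n)) :
  M^t* *m M = 1%:M -> hsnorm (M^t* *m v) <= hsnorm v.
Proof.
move=> hM; have hI : isometries (fun _ : 'I_1 => M) by rewrite /isometries big_ord1.
have := @compression_le _ _ _ _ _ (fun _ => v) _ hI erefl.
by rewrite !big_ord1.
Qed.

End Adjoint.

(** * Positive semidefinite matrices *)

Section Psd.
Variable C : numClosedFieldType.

Lemma form_hsnorm m n (x : 'rV[C]_m) (Z : 'M[C]_(m, n)) :
  (x *m (Z *m Z^t*) *m x^t*) 0 0 = hsnorm (x *m Z).
Proof.
by rewrite -hsnorm_adj /hsnorm /hsdot trmxCK adjmxM !mulmxA
   /mxtrace big_ord1.
Qed.

(** In [C], [0 <= z] entails that z is real, so hermitian symmetry is a consequence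
    ([psdmx_herm]). *)
Definition psdmx n (G : 'M[C]_n) := forall x : 'rV_n, 0 <= (x *m G *m x^t*) 0 0.

Lemma psdmx_gram m n (Z : 'M[C]_(m, n)) : psdmx (Z *m Z^t*).
Proof. by move=> x; rewrite form_hsnorm hsnorm_ge0. Qed.

Lemma psdmxD n (G H : 'M[C]_n) : psdmx G -> psdmx H -> psdmx (G + H).
Proof. by move=> hG hH x; rewrite mulmxDr mulmxDl mxE addr_ge0. Qed.

Lemma psdmx_sum n (I : finType) (G : I -> 'M[C]_n) :
  (forall i, psdmx (G i)) -> psdmx (\sum_i G i).
Proof.
move=> hG x; rewrite mulmx_sumr mulmx_suml summxE.
by apply: sumr_ge0 => i _; apply: hG.
Qed.

Lemma psdmxJ m n (M : 'M[C]_(m, n)) (G : 'M[C]_n) :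
  psdmx G -> psdmx (M *m G *m M^t*).
Proof. by move=> hG x; have := hG (x *m M); rewrite adjmxM !mulmxA. Qed.

Lemma form_entry n (G : 'M[C]_n) (i j : 'I_n) :
  ((delta_mx 0 i : 'rV_n) *m G *m (delta_mx 0 j : 'rV_n)^t*) 0 0 = G i j.
Proof. by rewrite -rowE trmx_delta map_delta_mx -colE !mxE. Qed.

(** Polarisation: the form at e_i + c e_j, for c = 1 and c = i, isolates the entries G_ij and
    G_ji. *)
Lemma form_eq0 n (G : 'M[C]_n) :
  (forall x : 'rV_n, (x *m G *m x^t*) 0 0 = 0) -> G = 0.
Proof.
move=> h; apply/matrixP => i j; rewrite [RHS]mxE.
have hd k : G k k = 0 by rewrite -form_entry.
have hc c : c^* * G i j + c * G j i = 0.
  have := h (delta_mx 0 i + c *: delta_mx 0 j).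
  rewrite adjmxD adjmxZ !mulmxDl !mulmxDr -!scalemxAl -!scalemxAr.
  have aE (A B : 'M[C]_1) : (A + B) 0 0 = A 0 0 + B 0 0 by rewrite mxE.
  have zE a (A : 'M[C]_1) : (a *: A) 0 0 = a * A 0 0 by rewrite mxE.
  by rewrite !(aE, zE) !form_entry !hd !mulr0 addr0 add0r addrC.
have h1 := hc 1; have := hc 'i.
rewrite conjCi rmorph1 !mul1r in h1 *.
have -> : G j i = - G i j by apply/eqP; rewrite -addr_eq0 addrC h1.
rewrite mulNr mulrN -opprD -mulr2n => /eqP.
by rewrite oppr_eq0 mulrn_eq0 /= mulf_eq0 (negbTE (neq0Ci _)) /= => /eqP.
Qed.

Lemma psdmx_herm n (G : 'M[C]_n) : psdmx G -> G^t* = G.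
Proof.
move=> hG; apply/eqP; rewrite -subr_eq0; apply/eqP/form_eq0 => x.
have hx : ((x *m G *m x^t*) 0 0)^* = (x *m G *m x^t*) 0 0.
  by rewrite conj_Creal ?ger0_real.
rewrite mulmxBr mulmxBl mxE [X in _ + X]mxE -hx.
have -> : x *m G^t* *m x^t* = (x *m G *m x^t*)^t*.
  by rewrite !adjmxM trmxCK mulmxA.
by rewrite 2!mxE subrr.
Qed.

Lemma hermitian_diag n (G : 'M[C]_n) : G^t* = G ->
  exists (U : 'M[C]_n) (d : 'rV[C]_n),
    [/\ U *m U^t* = 1%:M, U^t* *m U = 1%:M, G = U^t* *m diag_mx d *m U &
      forall i, d 0 i \is Num.real].
Proof.
move=> hG; have hh : G \is hermsymmx.
  by apply/is_hermitianmxP; rewrite expr0 scale1r hG.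
have hU := spectral_unitarymx G.
have /unitarymxP hU1 := hU.
exists (spectralmx G), (spectral_diag G); split => //.
- exact: mulmx1C.
- have /orthomx_spectralP {1}-> := hermitian_normalmx hh.
  by rewrite invmx_unitary.
- by move=> i; apply/mxOverP/hermitian_spectral_diag_real.
Qed.

Lemma form_diag n (x d : 'rV[C]_n) :
  (x *m diag_mx d *m x^t*) 0 0 = \sum_i d 0 i * `|x 0 i| ^+ 2.
Proof.
rewrite mul_mx_diag !mxE; apply: eq_bigr => i _.
by rewrite !mxE normCK mulrA [d 0 i * _]mulrC.
Qed.

Lemma diag_gram n (d : 'rV[C]_n) : (forall i, 0 <= d 0 i) ->
  diag_mx d = diag_mx (map_mx sqrtC d) *m (diag_mx (map_mx sqrtC d))^t*.
Proof.
move=> hd; rewrite tr_diag_mx map_diag_mx mulmx_diag; congr diag_mx.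
apply/rowP => i; rewrite !mxE /= conj_Creal ?ger0_real ?sqrtC_ge0//.
by rewrite -expr2 sqrtCK.
Qed.

Lemma psdmx_sqrt n (G : 'M[C]_n) :
  psdmx G -> exists Z : 'M[C]_n, G = Z *m Z^t*.
Proof.
move=> hG; have [U [d [hU1 hU2 hGd _]]] := hermitian_diag (psdmx_herm hG).
exists (U^t* *m diag_mx (map_mx sqrtC d)).
rewrite adjmxM trmxCK !mulmxA -[_ *m _ *m (diag_mx _)^t*]mulmxA -diag_gram//.
move=> i; have := hG (delta_mx 0 i *m U); rewrite hGd adjmxM !mulmxA.
rewrite -[_ *m U *m U^t*]mulmxA hU1 mulmx1 -[_ *m U *m U^t*]mulmxA hU1 mulmx1.
by rewrite form_entry mxE eqxx.
Qed.

(** With G = Z Z^*, the entry G_ii is the squared norm of the i-th row of Z. *)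
Lemma psdmx_diag0 n (G : 'M[C]_n) i : psdmx G -> G i i = 0 -> forall j, G i j = 0.
Proof.
move=> hG; have [Z ->] := psdmx_sqrt hG => h0 j.
have : hsnorm ((delta_mx 0 i : 'rV_n) *m Z) == 0.
  by rewrite -form_hsnorm form_entry h0.
rewrite hsnorm_eq0 => /eqP h.
by rewrite -[LHS]form_entry mulmxA h !mul0mx mxE.
Qed.

Lemma psdmx_diag_ge0 n (G : 'M[C]_n) i : psdmx G -> 0 <= G i i.
Proof. by move=> hG; rewrite -form_entry. Qed.

Lemma finite_real_max (I : finType) (i0 : I) (F : I -> C) :
  (forall i, F i \is Num.real) -> exists i, forall j, F j <= F i.
Proof.
move=> hF; have [//|i _ h] := @real_arg_maxP _ _ i0 predT F isT.
by exists i => j; apply: h.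
Qed.

(** Here c is the largest eigenvalue of M M^*, that is the squared operator norm of M, and x is an
    eigenvector for it. *)
Lemma max_gain p q (M : 'M[C]_(p, q)) : (0 < p)%N ->
  exists (c : C) (x : 'rV[C]_p), [/\ 0 <= c, x != 0,
    hsnorm (x *m M) = c * hsnorm x &
    forall w : 'rV_p, hsnorm (w *m M) <= c * hsnorm w].
Proof.
move=> p0; have hG := psdmx_gram M.
have [U [d [hU1 hU2 hGd hd]]] := hermitian_diag (psdmx_herm hG).
have [i hi] := finite_real_max (Ordinal p0) hd.
have hn (w : 'rV_p) : hsnorm w = \sum_j `|(w *m U^t*) 0 j| ^+ 2.
  rewrite -(hsnorm_adj w) -(@hsnorm_isometry _ _ _ _ U) // -hsnorm_adj adjmxM trmxCK.
  by rewrite hsnormE big_ord1.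
have hM (w : 'rV_p) : hsnorm (w *m M) = \sum_j d 0 j * `|(w *m U^t*) 0 j| ^+ 2.
  by rewrite -form_hsnorm hGd -form_diag adjmxM trmxCK !mulmxA.
have hx : (delta_mx 0 i *m U : 'rV_p) *m U^t* = delta_mx 0 i.
  by rewrite -mulmxA hU1 mulmx1.
have he j : `|(delta_mx 0 i : 'rV[C]_p) 0 j| ^+ 2 = (j == i)%:R.
  by rewrite mxE; case: (j == i); rewrite /= ?normr1 ?normr0 ?expr1n ?expr0n.
exists (d 0 i), (delta_mx 0 i *m U); split.
- have := psdmx_diag_ge0 i (psdmxJ U hG); rewrite hGd !mulmxA hU1 mul1mx.
  by rewrite -mulmxA hU1 mulmx1 mxE eqxx.
- apply/eqP => h; have := hx; rewrite h mul0mx => /rowP/(_ i).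
  by rewrite !mxE !eqxx => /eqP; rewrite eq_sym oner_eq0.
- rewrite hM hn hx; rewrite (bigD1 i)//= [X in _ = _ * X](bigD1 i)//=.
  rewrite !big1 ?addr0 // => j /negbTE hj; rewrite he hj ?mulr0//.
- move=> w; rewrite hM hn mulr_sumr; apply: ler_sum => j _.
  by rewrite ler_wpM2r ?exprn_ge0.
Qed.

(* A fixed point exists because the map preserves the trace; replacing it by
   its absolute value [|h|] keeps it fixed, since the image of [|h|] dominates
   both [h] and [-h] and has the same trace as [|h|]. *)
Lemma invariant_state (I : finType) r (T : I -> 'M[C]_r) :
  (0 < r)%N -> isometries T ->
  exists2 z : 'M[C]_r, z != 0 &
    \sum_k (T k *m z) *m (T k *m z)^t* = z *m z^t*.
Proof.
move=> r0 hT.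
pose Psi h := \sum_k T k *m h *m (T k)^t*.
have PsiD h h' : Psi (h + h') = Psi h + Psi h'.
  by rewrite /Psi -big_split /=; apply: eq_bigr => k _; rewrite mulmxDr mulmxDl.
have PsiZ c h : Psi (c *: h) = c *: Psi h.
  by rewrite /Psi scaler_sumr; apply: eq_bigr => k _; rewrite -scalemxAr -scalemxAl.
have Psi_tr h : \tr (Psi h) = \tr h.
  rewrite -[in RHS](mulmx1 h) -hT mulmx_sumr !raddf_sum; apply: eq_bigr => k _ /=.
  by rewrite mxtrace_mulC [in RHS]mxtrace_mulC !mulmxA mxtrace_mulC !mulmxA.
have Psi_adj h : (Psi h)^t* = Psi (h^t*).
  by rewrite adjmx_sum; apply: eq_bigr => k _; rewrite !adjmxM trmxCK mulmxA.
have Psi_psd h : psdmx h -> psdmx (Psi h).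
  by move=> hh; apply: psdmx_sum => k; apply: psdmxJ.
have [h0 h0n h0f] : exists2 h, h != 0 & Psi h = h.
  pose P := \sum_k lin_mulmx (T k) *m lin_mulmxr ((T k)^t*) - 1%:M.
  have PE h : mxvec h *m P = mxvec (Psi h - h).
    rewrite mulmxBr mulmx1 linearB /= mulmx_sumr; congr (_ - _).
    rewrite /Psi linear_sum; apply: eq_bigr => k _ /=.
    by rewrite mulmxA !mul_vec_lin.
  (* Were [Psi] minus the identity invertible, the identity matrix would lie in its image, which
     consists of matrices of trace 0. *)
  have : ~~ row_free P.
    apply/negP => hfree; have hfull : row_full P by rewrite row_full_unit -row_free_unit.
    have /submxP[D hD] := submx_full (mxvec 1%:M) hfull.
    have := PE (vec_mx D); rewrite vec_mxK -hD => /(can_inj mxvecK) h1.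
    have := congr1 mxtrace h1; rewrite linearB /= Psi_tr subrr mxtrace1 => /eqP.
    by rewrite pnatr_eq0 eqn0Ngt r0.
  rewrite -kermx_eq0 => /rowV0Pn[v /sub_kermxP hv v0].
  exists (vec_mx v); first by rewrite vec_mx_eq0.
  by apply/eqP; rewrite -subr_eq0 -mxvec_eq0 -PE vec_mxK hv.
have [h hn [hf hh]] : exists2 h, h != 0 & Psi h = h /\ h^t* = h.
  (* Either the hermitian part of [h0] is nonzero, or [h0] is antihermitian and multiplication by i
     makes it hermitian. *)
  have [hz|hz] := eqVneq (h0 + h0^t*) 0.
    exists ('i *: h0); first by rewrite scaler_eq0 negb_or neq0Ci h0n.
    split; first by rewrite PsiZ h0f.
    rewrite adjmxZ conjCi; have -> : h0^t* = - h0.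
      by apply/eqP; rewrite -addr_eq0 addrC hz.
    by rewrite scalerN scaleNr opprK.
  exists (h0 + h0^t*) => //; split; first by rewrite PsiD -Psi_adj h0f.
  by rewrite adjmxD trmxCK addrC.
have [U [d [hU1 hU2 hd dR]]] := hermitian_diag hh.
pose D : 'rV[C]_r := \row_i `|d 0 i|.
have D0 i : 0 <= D 0 i by rewrite mxE.
pose a := U^t* *m diag_mx D *m U.
have aE : a = (U^t* *m diag_mx (map_mx sqrtC D)) *m
              (U^t* *m diag_mx (map_mx sqrtC D))^t*.
  by rewrite adjmxM trmxCK !mulmxA -[_ *m _ *m (diag_mx _)^t*]mulmxA -diag_gram.
suff Psia : Psi a = a.
  exists (U^t* *m diag_mx (map_mx sqrtC D)).
    apply: contra_neq hn => z0; rewrite hd.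
    have a0 : a = 0 by rewrite aE z0 mul0mx.
    suff -> : d = 0 by rewrite linear0 mulmx0 mul0mx.
    apply/rowP => i; rewrite [RHS]mxE.
    have /matrixP/(_ i i) : U *m a *m U^t* = 0 by rewrite a0 mulmx0 mul0mx.
    rewrite /a !mulmxA hU1 mul1mx -mulmxA hU1 mulmx1 !mxE eqxx mulr1n.
    by move/normr0_eq0.
  rewrite -aE -[RHS]Psia aE /Psi; apply: eq_bigr => k _.
  by rewrite [in LHS]adjmxM !mulmxA.
have conjU (e : 'rV[C]_r) : U *m (U^t* *m diag_mx e *m U) *m U^t* = diag_mx e.
  by rewrite !mulmxA hU1 mul1mx -mulmxA hU1 mulmx1.
pose G := U *m Psi a *m U^t*.
have Gpm s : (s = 1) \/ (s = -1) -> psdmx (G + s *: diag_mx d).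
  move=> hs; have -> : G + s *: diag_mx d = U *m Psi (a + s *: h) *m U^t*.
    by rewrite PsiD PsiZ hf mulmxDr mulmxDl -scalemxAr -scalemxAl hd conjU.
  apply/psdmxJ/Psi_psd.
  have -> : a + s *: h = U^t* *m diag_mx (D + s *: d) *m U^t*^t*.
    by rewrite {1}hd trmxCK linearD linearZ /= mulmxDr mulmxDl -scalemxAr -scalemxAl.
  apply: psdmxJ => x; rewrite form_diag; apply: sumr_ge0 => i _.
  rewrite mulr_ge0 ?exprn_ge0// !mxE.
  case: hs => ->; rewrite ?mul1r ?mulN1r ?subr_ge0 ?real_ler_norm//.
  by rewrite -[X in _ + X]opprK subr_ge0 -normrN real_ler_norm ?rpredN.
have Gs s i j : (G + s *: diag_mx d) i j = G i j + s * (d 0 i *+ (i == j)).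
  by rewrite mxE; congr (_ + _); rewrite 2!mxE.
have hG i : D 0 i <= G i i.
  have h1 := psdmx_diag_ge0 i (Gpm 1 (or_introl erefl)).
  have h2 := psdmx_diag_ge0 i (Gpm (-1) (or_intror erefl)).
  rewrite Gs eqxx mulr1n mul1r in h1; rewrite Gs eqxx mulr1n mulN1r subr_ge0 in h2.
  rewrite mxE; case: (real_ge0P (dR i)) => _; first exact: h2.
  by rewrite -subr_ge0 opprK.
have trG : \tr G = \sum_i D 0 i.
  rewrite /G mxtrace_mulC mulmxA hU2 mul1mx Psi_tr /a mxtrace_mulC mulmxA hU1 mul1mx.
  by apply: eq_bigr => i _; rewrite mxE eqxx.
have GD i : G i i = D 0 i.
  apply/eqP; rewrite -subr_eq0; apply/eqP.
  have : \sum_i (G i i - D 0 i) == 0 by rewrite sumrB -trG subrr.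
  rewrite psumr_eq0 => [/allP/(_ i (mem_index_enum _))/= /eqP//|j _].
  by rewrite subr_ge0.
have -> : Psi a = U^t* *m G *m U.
  by rewrite /G !mulmxA hU2 mul1mx -mulmxA hU2 mulmx1.
rewrite /a; congr (_ *m _ *m _); apply/matrixP => i j.
(* For this sign s the semidefinite matrix G + s diag(d) has a zero i-th diagonal entry, hence a
   zero i-th row: off the diagonal G vanishes. *)
have hs s : (s = 1) \/ (s = -1) -> s * d 0 i = - `|d 0 i| ->
    G i j = diag_mx D i j.
  move=> hs hsd; have hz : (G + s *: diag_mx d) i i = 0.
    by rewrite Gs eqxx mulr1n hsd GD mxE subrr.
  have := psdmx_diag0 (Gpm s hs) hz j; rewrite Gs mulrnAr hsd => h2.
  by apply/eqP; rewrite -subr_eq0 -[X in _ == X]h2 !mxE mulNrn.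
case: (real_ge0P (dR i)) => hdi.
  by apply: (hs (-1)); [right|rewrite mulN1r ger0_norm].
by apply: (hs 1); [left|rewrite mul1r ltr0_norm// opprK].
Qed.

End Psd.

(** * Rigidity of compressions *)

Section Vectorisation.
Variable C : numClosedFieldType.

Lemma hsnorm_mxvec m n (v : 'M[C]_(m, n)) : hsnorm (mxvec v) = hsnorm v.
Proof.
rewrite !hsnormE big_ord1 pair_bigA /=.
rewrite (reindex _ (curry_mxvec_bij m n)) /=.
by apply: eq_bigr => -[i j] _ /=; rewrite mxvecE.
Qed.

(** Each row of y is a vector of C^a (x) C^n. This is the reduced density on C^a of their
    unnormalised mixture: a partial trace of y^* y, on which it depends linearly. *)
Definition partial_gram r a n (y : 'M[C]_(r, a * n)) : 'M[C]_a :=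
  \sum_b vec_mx (row b y) *m (vec_mx (row b y))^t*.

Lemma partial_gramE r a n (y : 'M[C]_(r, a * n)) i j :
  partial_gram y i j = \sum_k (y^t* *m y) (mxvec_index j k) (mxvec_index i k).
Proof.
rewrite summxE; under [RHS]eq_bigr => k _ do rewrite mxE.
rewrite exchange_big; apply: eq_bigr => b _ /=; rewrite mxE.
by apply: eq_bigr => k _; rewrite !mxE mulrC.
Qed.

Lemma partial_gram_sum (I : finType) r a n (Y : I -> 'M[C]_(r, a * n))
    (y : 'M[C]_(r, a * n)) :
  \sum_k (Y k)^t* *m Y k = y^t* *m y ->
  \sum_k partial_gram (Y k) = partial_gram y.
Proof.
move=> h; apply/matrixP => i j; rewrite summxE partial_gramE -h.
under eq_bigr => k _ do rewrite partial_gramE.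
by rewrite exchange_big; apply: eq_bigr => k _; rewrite summxE.
Qed.

Lemma psdmx_partial_gram r a n (y : 'M[C]_(r, a * n)) : psdmx (partial_gram y).
Proof. by apply: psdmx_sum => b; apply: psdmx_gram. Qed.

Lemma partial_gram_ker r a n (y : 'M[C]_(r, a * n)) (x : 'rV[C]_a) :
  (x *m partial_gram y *m x^t*) 0 0 = 0 ->
  forall b, x *m vec_mx (row b y) = 0.
Proof.
rewrite mulmx_sumr mulmx_suml summxE => /eqP; rewrite psumr_eq0; last first.
  by move=> b _; rewrite form_hsnorm hsnorm_ge0.
move=> /allP h b; have := h b (mem_index_enum _).
by rewrite /= form_hsnorm hsnorm_eq0 => /eqP.
Qed.

(** The columns of Q are an orthonormal basis of the range of rho. The condition on v says that its
    columns are orthogonal to the kernel of rho, that is lie in this range. *)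
Lemma support_isometry a (rho : 'M[C]_a) : psdmx rho ->
  exists2 Q : 'M[C]_(a, \rank rho), Q^t* *m Q = 1%:M &
    forall n (v : 'M[C]_(a, n)),
      (forall x : 'rV_a, (x *m rho *m x^t*) 0 0 = 0 -> x *m v = 0) ->
      Q *m (Q^t* *m v) = v.
Proof.
move=> hrho; pose B := schmidt (row_base rho).
have /unitarymxP hB : B \is unitarymx.
  by apply: schmidt_unitarymx; apply: rank_leq_col.
exists (B^t*); rewrite trmxCK // => n v hv.
have /submxP[Y hY] : (rho <= B)%MS.
  by rewrite eqmx_schmidt_free ?row_base_free// eq_row_base.
apply/eqP; rewrite -subr_eq0 -oppr_eq0 opprB mulmxA -[X in X - _]mul1mx -mulmxBl.
apply/eqP/row_matrixP => i; rewrite row0 row_mul; apply: hv.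
suff -> : row i (1%:M - B^t* *m B) *m rho = 0 by rewrite mul0mx mxE.
have hY' : rho = B^t* *m Y^t* by rewrite -adjmxM -hY psdmx_herm.
suff h (M : 'M[C]_a) : M = B^t* *m Y^t* -> (1%:M - B^t* *m B) *m M = 0.
  by rewrite -row_mul h// row0.
by move=> ->; rewrite mulmxBl mul1mx -!mulmxA [B *m _]mulmxA hB mul1mx subrr.
Qed.

End Vectorisation.

Section Rigidity.
Variables (C : numClosedFieldType) (g : nat).

(** The action of A(X^T) on C^a (x) C^n, a vector being written as an a by n matrix;
    [pencil_eval_tensvec] makes the link, which is why points appear transposed later. Rectangular
    points arise in the duality argument. *)
Definition ev a' a (A : 'I_g -> 'M[C]_(a', a)) n n' (X : 'I_g -> 'M[C]_(n, n'))
    (v : 'M[C]_(a, n)) : 'M[C]_(a', n') := \sum_j A j *m v *m X j.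

Definition gain_le a' a (A : 'I_g -> 'M[C]_(a', a)) n n'
    (X : 'I_g -> 'M[C]_(n, n')) (c : C) :=
  forall v, hsnorm (ev A X v) <= c * hsnorm v.

(** Minimality among the pencils with the same norms as A; nondegeneracy passes to such pencils
    ([minimal_norm_minimal]). *)
Definition norm_minimal a' a (A : 'I_g -> 'M[C]_(a', a)) :=
  forall d' d (B : 'I_g -> 'M[C]_(d', d)),
    (forall n (X : 'I_g -> 'M[C]_n) c, gain_le A X c <-> gain_le B X c) ->
    (a' * a <= d' * d)%N.

(** Passing from [A j *m r] to the [B j *m V k *m r], and from these to the
    [A j *m V' m *m V k *m r], can only increase the total norm. Invariance of r r^* makes the last
    total equal to the first norm, so the first passage is an equality case of compression; r is
    then cancelled. *)
Lemma compression_intertwines (I J : finType) a' a b' b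
    (A : 'I_g -> 'M[C]_(a', a)) (B : 'I_g -> 'M[C]_(b', b))
    (W : I -> 'M[C]_(b', a')) (V : I -> 'M[C]_(b, a))
    (W' : J -> 'M[C]_(a', b')) (V' : J -> 'M[C]_(a, b)) (r : 'M[C]_a) :
  isometries W -> isometries W' ->
  (forall j, A j = \sum_k (W k)^t* *m B j *m V k) ->
  (forall j, B j = \sum_k (W' k)^t* *m A j *m V' k) ->
  r \in unitmx ->
  \sum_(k : J * I) (V' k.1 *m V k.2 *m r) *m (V' k.1 *m V k.2 *m r)^t* = r *m r^t* ->
  forall j k, B j *m V k = W k *m A j.
Proof.
move=> hW hW' hA hB hr hinv j.
suff h k : B j *m V k *m r = W k *m (A j *m r).
  by move=> k; apply: (can_inj (mulmxK hr)); rewrite h mulmxA.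
apply: (compression_eq (y := fun k => B j *m V k *m r) hW _ _ k).
  by rewrite {1}hA mulmx_suml; apply: eq_bigr => i _; rewrite !mulmxA.
apply: (@le_trans _ _ (\sum_i \sum_m hsnorm (A j *m (V' m *m V i *m r)))).
  apply: ler_sum => i _; apply: (compression_le hW').
  by rewrite hB !mulmx_suml; apply: eq_bigr => m _; rewrite !mulmxA.
rewrite exchange_big pair_bigA /= -[leRHS]hsnorm_adj.
have -> : hsnorm ((A j *m r)^t*) = \tr (A j *m (r *m r^t*) *m (A j)^t*).
  by rewrite /hsnorm /hsdot trmxCK adjmxM !mulmxA.
rewrite -hinv mulmx_sumr mulmx_suml raddf_sum; apply: ler_sum => l _ /=.
by rewrite -[leLHS]hsnorm_adj /hsnorm /hsdot trmxCK adjmxM !mulmxA.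
Qed.

(** The vectors at which A attains its gain at X form a space stable under all [T k], and there A
    turns [T k] into [S k]. An invariant state on that space has reduced densities [rho] for the
    vectors and [rho'] for their images; v is one of the vectors making up the state, so both
    supports contain what they must. *)
Lemma recurrent_vector (I : finType) a' a (A : 'I_g -> 'M[C]_(a', a))
    (S : I -> 'M[C]_a') (T : I -> 'M[C]_a) n (X : 'I_g -> 'M[C]_n) :
  isometries S -> isometries T ->
  (forall j, A j = \sum_k (S k)^t* *m A j *m T k) ->
  (0 < a * n)%N ->
  exists (rho : 'M[C]_a) (rho' : 'M[C]_a') (c : C) (v : 'M[C]_(a, n)),
  [/\ psdmx rho /\ \sum_k T k *m rho *m (T k)^t* = rho,
      psdmx rho' /\ \sum_k S k *m rho' *m (S k)^t* = rho',
      [/\ v != 0, hsnorm (ev A X v) = c * hsnorm v & gain_le A X c],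
      forall x : 'rV_a, (x *m rho *m x^t*) 0 0 = 0 -> x *m v = 0 &
      forall x : 'rV_a', (x *m rho' *m x^t*) 0 0 = 0 -> x *m ev A X v = 0].
Proof.
move=> hS hT hA an0.
pose P := \sum_j lin_mulmx (A j) *m lin_mulmxr (X j) : 'M[C]_(a * n, a' * n).
have PE v : mxvec v *m P = mxvec (ev A X v).
  rewrite /P mulmx_sumr /ev linear_sum; apply: eq_bigr => j _.
  by rewrite mulmxA !mul_vec_lin.
have PE' (w : 'rV_(a * n)) : w *m P = mxvec (ev A X (vec_mx w)) by rewrite -PE vec_mxK.
have [c [x [c0 x0 hx hc]]] := max_gain P an0.
have hgain : gain_le A X c.
  by move=> v; rewrite -hsnorm_mxvec -PE -(hsnorm_mxvec v).
have evS v : ev A X v = \sum_k (S k)^t* *m ev A X (T k *m v).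
  under eq_bigr => k _ do rewrite /ev mulmx_sumr.
  rewrite exchange_big; apply: eq_bigr => j _ /=; rewrite {1}hA !mulmx_suml.
  by apply: eq_bigr => k _; rewrite !mulmxA.
have att v : hsnorm (ev A X v) = c * hsnorm v -> forall k,
    ev A X (T k *m v) = S k *m ev A X v /\
    hsnorm (ev A X (T k *m v)) = c * hsnorm (T k *m v).
  move=> hv.
  have h1 : \sum_k hsnorm (ev A X (T k *m v)) <= hsnorm (ev A X v).
    rewrite hv -(isometries_norm v hT) mulr_sumr; apply: ler_sum => k _.
    exact: hgain.
  have h2 := compression_eq hS (evS v) h1; move=> k; split; first exact: h2.
  have : \sum_k (c * hsnorm (T k *m v) - hsnorm (ev A X (T k *m v))) == 0.
    rewrite sumrB -mulr_sumr (isometries_norm _ hT) -hv.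
    by under [X in _ - X]eq_bigr => i _ do rewrite h2; rewrite (isometries_norm _ hS) subrr.
  rewrite psumr_eq0 => [/allP/(_ k (mem_index_enum _))|i _]; last by rewrite subr_ge0.
  by rewrite /= subr_eq0 => /eqP.
(* [D] is positive semidefinite, so the vectors of maximal gain are exactly its kernel: a linear
   subspace. *)
pose D := c%:M - P *m P^t*.
have Dform (w : 'rV_(a * n)) : (w *m D *m w^t*) 0 0 = c * hsnorm w - hsnorm (w *m P).
  rewrite mulmxBr mulmxBl.
  rewrite [LHS]mxE [X in _ + X]mxE form_hsnorm; congr (_ - _).
  by rewrite mul_mx_scalar -scalemxAl mxE -hsnorm_adj /hsnorm /hsdot trmxCK /mxtrace big_ord1.
have Dpsd : psdmx D by move=> w; rewrite Dform subr_ge0.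
have kerD (w : 'rV_(a * n)) : (w <= kermx D)%MS <-> hsnorm (w *m P) = c * hsnorm w.
  split => [/sub_kermxP h|h].
    by apply/eqP; rewrite eq_sym -subr_eq0 -Dform h mul0mx mxE.
  have [Z hZ] := psdmx_sqrt Dpsd; apply/sub_kermxP; rewrite hZ mulmxA.
  suff /eqP -> : w *m Z == 0 by rewrite mul0mx.
  by rewrite -hsnorm_eq0 -form_hsnorm -hZ Dform h subrr.
pose K := kermx D; pose Q := schmidt (row_base K).
have QK : (Q :=: K)%MS.
  by apply: (eqmx_trans (eqmx_schmidt_free (row_base_free _))); apply: eq_row_base.
have hQ : Q *m Q^t* = 1%:M.
  by apply/unitarymxP/schmidt_unitarymx; apply: rank_leq_col.
have r0 : (0 < \rank K)%N.
  rewrite lt0n mxrank_eq0; apply: contraNneq x0 => K0.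
  by have /kerD := hx; rewrite -/K K0 submx0.
pose Th k := lin_mulmx (T k) : 'M[C]_(a * n).
have ThE k (w : 'rV_(a * n)) : w *m Th k = mxvec (T k *m vec_mx w).
  by rewrite -[in LHS](vec_mxK w) mul_vec_lin.
have hTh : \sum_k Th k *m (Th k)^t* = 1%:M.
  apply/eqP; rewrite -subr_eq0; apply/eqP/form_eq0 => w.
  rewrite mulmxBr mulmxBl mulmx1 mxE mulmx_sumr mulmx_suml summxE.
  under eq_bigr => k _ do rewrite form_hsnorm ThE hsnorm_mxvec.
  rewrite (isometries_norm _ hT) -hsnorm_mxvec vec_mxK mxE.
  by rewrite -hsnorm_adj /hsnorm /hsdot trmxCK /mxtrace big_ord1 subrr.
have QTh k : (Q *m Th k <= Q)%MS.
  apply/row_subP => i; rewrite row_mul QK; apply/kerD; rewrite ThE PE' mxvecK.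
  rewrite !hsnorm_mxvec; apply: (att _ _ k).2.
  rewrite -hsnorm_mxvec -PE' -[in RHS]hsnorm_mxvec vec_mxK; apply/kerD.
  by rewrite -/K -QK row_sub.
pose tau k := Q *m Th k *m Q^t*.
have tauQ k : tau k *m Q = Q *m Th k.
  have /submxP[F hF] := QTh k.
  by rewrite /tau hF -[F *m Q *m _]mulmxA hQ mulmx1.
(* [tau k] is [T k] restricted to the maximal space, in the orthonormal basis Q. It acts on row
   vectors from the right, so its adjoints are what forms an isometric column. *)
have htau : isometries (fun k => (tau k)^t*).
  rewrite /isometries -hQ -[X in X *m Q^t*](mulmx1 Q) -hTh mulmx_sumr mulmx_suml.
  apply: eq_bigr => k _; by rewrite trmxCK {2}/tau !adjmxM trmxCK !mulmxA tauQ.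
have [z z0 hz] := invariant_state r0 htau.
(* The rows of y are vectors of maximal gain, and y^* y is the invariant density z z^* carried back
   to the whole space. *)
have [y yE] : exists y, y = z^t* *m Q by eexists.
have yinv : \sum_k (y *m Th k)^t* *m (y *m Th k) = y^t* *m y.
  rewrite yE adjmxM trmxCK !mulmxA -[Q^t* *m z *m _]mulmxA -hz mulmx_sumr mulmx_suml.
  apply: eq_bigr => k _; by rewrite -!mulmxA -tauQ !adjmxM !trmxCK !mulmxA.
have yK b : hsnorm (ev A X (vec_mx (row b y))) = c * hsnorm (vec_mx (row b y)).
  rewrite -hsnorm_mxvec -PE' -[in RHS]hsnorm_mxvec vec_mxK; apply/kerD.
  by rewrite -/K -QK yE row_mul submxMl.
have TyE k b : vec_mx (row b (y *m Th k)) = T k *m vec_mx (row b y).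
  by rewrite row_mul ThE mxvecK.
have SyE k b : vec_mx (row b (y *m Th k *m P)) = S k *m vec_mx (row b (y *m P)).
  rewrite row_mul PE' mxvecK TyE (att _ (yK b) k).1.
  by rewrite row_mul PE' mxvecK.
have [b hb] : exists b, row b y != 0.
  apply/existsP; apply: contraNT z0 => /existsPn h.
  suff y0 : y = 0.
    by rewrite -[z]trmxCK -[z^t*]mulmx1 -hQ mulmxA -yE y0 mul0mx adjmx0.
  by apply/row_matrixP => i; apply/eqP; rewrite row0; have := h i; rewrite negbK.
exists (partial_gram y), (partial_gram (y *m P)), c, (vec_mx (row b y)); split.
- split; first exact: psdmx_partial_gram.
  rewrite -[RHS](partial_gram_sum yinv); apply: eq_bigr => k _.
  rewrite mulmx_sumr mulmx_suml; apply: eq_bigr => i _.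
  by rewrite TyE adjmxM !mulmxA.
- split; first exact: psdmx_partial_gram.
  have yinv' : \sum_k (y *m Th k *m P)^t* *m (y *m Th k *m P) = (y *m P)^t* *m (y *m P).
    rewrite [(y *m P)^t*]adjmxM !mulmxA -[P^t* *m _ *m y]mulmxA -yinv mulmx_sumr mulmx_suml.
    by apply: eq_bigr => k _; rewrite !adjmxM !mulmxA.
  rewrite -[RHS](partial_gram_sum yinv'); apply: eq_bigr => k _.
  rewrite mulmx_sumr mulmx_suml; apply: eq_bigr => i _.
  by rewrite SyE adjmxM !mulmxA.
- by split => //; rewrite vec_mx_eq0.
- by move=> w hw; apply: partial_gram_ker hw b.
- move=> w hw; have := partial_gram_ker hw b.
  by rewrite row_mul PE' mxvecK.
Qed.

End Rigidity.

Lemma exists_maximal_nat (P : nat -> Prop) (N : nat) :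
  (exists n, P n) -> (forall n, P n -> (n <= N)%N) ->
  exists2 n, P n & forall m, P m -> (m <= n)%N.
Proof.
move=> [n0 hn0] hN.
have h : exists n, `[< P n >] by exists n0; apply/asboolP.
have hb n : `[< P n >] -> (n <= N)%N by move/asboolP; apply: hN.
case: (ex_maxnP h hb) => n /asboolP hn hmax.
by exists n => // m hm; apply: hmax; apply/asboolP.
Qed.

(** * Kernels and ranks of sums of positive semidefinite matrices; invariant densities of full
    rank *)

Section PsdRank.
Variable C : numClosedFieldType.

Lemma psdmx_form0 n (G : 'M[C]_n) (x : 'rV_n) :
  psdmx G -> (x *m G *m x^t*) 0 0 = 0 -> x *m G = 0.
Proof.
move=> hG; have [Z ->] := psdmx_sqrt hG; rewrite form_hsnorm => /eqP.
by rewrite hsnorm_eq0 mulmxA => /eqP ->; rewrite mul0mx.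
Qed.

Lemma form_ker n (G : 'M[C]_n) (x : 'rV_n) :
  x *m G = 0 -> (x *m G *m x^t*) 0 0 = 0.
Proof. by move=> ->; rewrite mul0mx mxE. Qed.

Lemma psdmx_kerD n (G H : 'M[C]_n) : psdmx G -> psdmx H ->
  (kermx (G + H) <= kermx G)%MS /\ (kermx (G + H) <= kermx H)%MS.
Proof.
move=> hG hH.
have h i : (row i (kermx (G + H)) *m G = 0) /\ (row i (kermx (G + H)) *m H = 0).
  set x := row i _.
  have hx : x *m (G + H) = 0 by apply/sub_kermxP/row_sub.
  have := form_ker hx; rewrite mulmxDr mulmxDl mxE => /eqP.
  rewrite paddr_eq0 ?hG ?hH// => /andP[/eqP h1 /eqP h2].
  by split; apply: psdmx_form0.
by split; apply/row_subP => i; apply/sub_kermxP; have [] := h i.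
Qed.

Lemma psdmx_rankD n (G H : 'M[C]_n) : psdmx G -> psdmx H ->
  (\rank G <= \rank (G + H)%R)%N.
Proof.
move=> hG hH; have [/mxrankS h _] := psdmx_kerD hG hH.
by move: h; rewrite !mxrank_ker leq_sub2lE ?rank_leq_row.
Qed.

(** The kernel of a sum is the intersection of the kernels, so a G whose rank does not grow under
    addition of H already supports H. *)
Lemma psdmx_rankD_eq n (G H : 'M[C]_n) (x : 'rV_n) : psdmx G -> psdmx H ->
  (\rank (G + H)%R <= \rank G)%N -> x *m G = 0 -> x *m H = 0.
Proof.
move=> hG hH hr /sub_kermxP hx; have [h1 h2] := psdmx_kerD hG hH.
apply/sub_kermxP/(submx_trans _ h2)/(submx_trans hx).
by rewrite -(geq_leqif (mxrank_leqif_sup h1)) !mxrank_ker leq_sub2l.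
Qed.

End PsdRank.

Section Rigidity.
Variables (C : numClosedFieldType) (g : nat).

Lemma gain_le_compress a' a b' b (A : 'I_g -> 'M[C]_(a', a))
    (Q' : 'M[C]_(a', b')) (Q : 'M[C]_(a, b)) n n' (X : 'I_g -> 'M[C]_(n, n')) c :
  Q'^t* *m Q' = 1%:M -> Q^t* *m Q = 1%:M ->
  gain_le A X c -> gain_le (fun j => Q'^t* *m A j *m Q) X c.
Proof.
move=> hQ' hQ h v.
have -> : ev (fun j => Q'^t* *m A j *m Q) X v = Q'^t* *m ev A X (Q *m v).
  by rewrite /ev mulmx_sumr; apply: eq_bigr => j _; rewrite !mulmxA.
apply: (le_trans (hsnorm_adj_isom _ hQ')).
by rewrite -(hsnorm_isometry v hQ).
Qed.

Lemma gain_le0 a' a (A : 'I_g -> 'M[C]_(a', a)) (X : 'I_g -> 'M[C]_0) c :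
  gain_le A X c.
Proof.
by move=> v; rewrite [ev _ _ _]thinmx0 [v]thinmx0 !hsnorm0 mulr0.
Qed.

Lemma leq_mul_eq r' r a' a : (r' <= a')%N -> (r <= a)%N -> (0 < a' * a)%N ->
  (a' * a <= r' * r)%N -> r' = a' /\ r = a.
Proof.
move=> h1 h2; rewrite muln_gt0 => /andP[a'0 a0] h.
split; apply/eqP; rewrite eqn_leq ?h1 ?h2 /= leqNgt; apply/negP => hlt.
  have : (r' * r < a' * a)%N by rewrite (leq_ltn_trans (leq_mul (leqnn r') h2)) ?ltn_pmul2r.
  by rewrite ltnNge h.
have : (r' * r < a' * a)%N by rewrite (leq_ltn_trans (leq_mul h1 (leqnn r))) ?ltn_pmul2l.
by rewrite ltnNge h.
Qed.

(** Take invariant densities of maximal rank. Their supports contain recurrent vectors at every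
    point X, so A compressed to the supports keeps all its norms, and minimality leaves no room for
    proper supports. *)
Lemma faithful_invariants (I : finType) a' a (A : 'I_g -> 'M[C]_(a', a))
    (S : I -> 'M[C]_a') (T : I -> 'M[C]_a) :
  norm_minimal A -> (0 < a' * a)%N ->
  isometries S -> isometries T ->
  (forall j, A j = \sum_k (S k)^t* *m A j *m T k) ->
  (exists2 r : 'M[C]_a, r \in unitmx &
     \sum_k (T k *m r) *m (T k *m r)^t* = r *m r^t*) /\
  (exists2 r : 'M[C]_a', r \in unitmx &
     \sum_k (S k *m r) *m (S k *m r)^t* = r *m r^t*).
Proof.
move=> hmin a0 hS hT hA.
pose inv m (R : I -> 'M[C]_m) (rho : 'M[C]_m) :=
  psdmx rho /\ \sum_k R k *m rho *m (R k)^t* = rho.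
have invD m (R : I -> 'M[C]_m) r1 r2 : inv m R r1 -> inv m R r2 -> inv m R (r1 + r2).
  move=> [p1 i1] [p2 i2]; split; first exact: psdmxD.
  rewrite -[in RHS]i1 -[in RHS]i2 -big_split; apply: eq_bigr => k _ /=.
  by rewrite mulmxDr mulmxDl.
have inv0 m (R : I -> 'M[C]_m) : inv m R 0.
  split=> [x|]; first by rewrite mulmx0 mul0mx mxE.
  by rewrite big1 // => k _; rewrite mulmx0 mul0mx.
have inv_sqrt m (R : I -> 'M[C]_m) rho : inv m R rho -> \rank rho = m ->
    exists2 r : 'M[C]_m, r \in unitmx &
      \sum_k (R k *m r) *m (R k *m r)^t* = r *m r^t*.
  move=> [hp hi] hr; have [r hrr] := psdmx_sqrt hp.
  have : rho \in unitmx by rewrite -row_free_unit /row_free hr.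
  rewrite hrr unitmx_mul => /andP[hu _]; exists r => //.
  rewrite -hrr -[RHS]hi hrr; apply: eq_bigr => k _.
  by rewrite adjmxM !mulmxA.
pose P k := exists rho rho', [/\ inv a T rho, inv a' S rho' &
  (\rank rho + \rank rho')%N = k].
have [k [rho [rho' [hr hr' hk]]] hmax] : exists2 k, P k & forall m, P m -> (m <= k)%N.
  apply: (exists_maximal_nat (N := (a + a')%N)).
    by exists 0%N, 0, 0; split => //; rewrite !mxrank0.
  by move=> m [r [r' [_ _ <-]]]; rewrite leq_add ?rank_leq_row.
(* Maximality of the sum of ranks yields maximality of each, because neither rank can drop when an
   invariant density is added. *)
have maxD r r' : inv a T r -> inv a' S r' ->
    (\rank (rho + r)%R <= \rank rho)%N /\ (\rank (rho' + r')%R <= \rank rho')%N.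
  move=> h h'; have hle := hmax _ (ex_intro _ _ (ex_intro _ _
    (And3 (invD _ _ _ _ hr h) (invD _ _ _ _ hr' h') erefl))).
  have h1 := psdmx_rankD hr.1 h.1; have h2 := psdmx_rankD hr'.1 h'.1.
  rewrite -hk in hle; split.
    by rewrite -(leq_add2r (\rank rho')) (leq_trans _ hle)// leq_add2l.
  by rewrite -(leq_add2l (\rank rho)) (leq_trans _ hle)// leq_add2r.
have [Q hQ QP] := support_isometry hr.1.
have [Q' hQ' QP'] := support_isometry hr'.1.
have : (a' * a <= \rank rho' * \rank rho)%N.
  apply: (hmin _ _ (fun j => Q'^t* *m A j *m Q)) => n X c.
  split; first exact: gain_le_compress.
  have [n0|n0] := posnP n; first by subst n => _; apply: gain_le0.
  have an0 : (0 < a * n)%N.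
    by move: a0; rewrite !muln_gt0 n0 andbT => /andP[].
  have [r [r' [c0 [v [hi hi' [v0 hv hg] hs hs']]]]] := recurrent_vector X hS hT hA an0.
  have [hmx hmx'] := maxD _ _ hi hi'.
  have hQv : Q *m (Q^t* *m v) = v.
    apply: QP => x /(psdmx_form0 hr.1) hx; apply/hs/form_ker.
    exact: psdmx_rankD_eq hr.1 hi.1 hmx hx.
  have hQu : Q' *m (Q'^t* *m ev A X v) = ev A X v.
    apply: QP' => x /(psdmx_form0 hr'.1) hx; apply/hs'/form_ker.
    exact: psdmx_rankD_eq hr'.1 hi'.1 hmx' hx.
  move=> hc w; apply: (le_trans (hg w)); rewrite ler_wpM2r ?hsnorm_ge0//.
  have v00 : 0 < hsnorm v by rewrite hsnorm_gt0.
  (* Both v and its image lie in the supports, so the compressed pencil has the full gain [c0] of A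
     at the compression of v; hence c0 <= c. *)
  rewrite -(ler_pM2r v00) -hv -hQu (hsnorm_isometry _ hQ') -{2}hQv (hsnorm_isometry _ hQ).
  have := hc (Q^t* *m v).
  have -> : ev (fun j => Q'^t* *m A j *m Q) X (Q^t* *m v) = Q'^t* *m ev A X v.
    rewrite -[in RHS]hQv /ev mulmx_sumr; apply: eq_bigr => j _.
    by rewrite !mulmxA.
  by [].
move=> /(leq_mul_eq (rank_leq_row _) (rank_leq_row _) a0)[e' e].
by split; [apply: inv_sqrt hr e|apply: inv_sqrt hr' e'].
Qed.

(** The second relation is the first one for the adjoint pencils, where V and W exchange roles; this
    is what the invertible density on the codomain side serves. *)
Lemma compression_rigid (I J : finType) a' a b' b
    (A : 'I_g -> 'M[C]_(a', a)) (B : 'I_g -> 'M[C]_(b', b))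
    (W : I -> 'M[C]_(b', a')) (V : I -> 'M[C]_(b, a))
    (W' : J -> 'M[C]_(a', b')) (V' : J -> 'M[C]_(a, b)) :
  norm_minimal A -> (0 < a' * a)%N ->
  isometries W -> isometries V -> isometries W' -> isometries V' ->
  (forall j, A j = \sum_k (W k)^t* *m B j *m V k) ->
  (forall j, B j = \sum_k (W' k)^t* *m A j *m V' k) ->
  forall k, (forall j, B j *m V k = W k *m A j) /\
            (forall j, (B j)^t* *m W k = V k *m (A j)^t*).
Proof.
move=> hmin a0 hW hV hW' hV' hA hB.
have hfix j : A j = \sum_(k : J * I) (W' k.1 *m W k.2)^t* *m A j *m (V' k.1 *m V k.2).
  rewrite -(pair_bigA _ (fun m k => (W' m *m W k)^t* *m A j *m (V' m *m V k))) /=.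
  rewrite exchange_big {1}hA; apply: eq_bigr => k _ /=.
  rewrite hB mulmx_sumr mulmx_suml; apply: eq_bigr => m _.
  by rewrite adjmxM !mulmxA.
have [[r hr ri] [r' hr' ri']] := faithful_invariants hmin a0
  (isometries_comp hW' hW) (isometries_comp hV' hV) hfix.
have h1 := compression_intertwines hW hW' hA hB hr ri.
have hA' j : (A j)^t* = \sum_k (V k)^t* *m (B j)^t* *m W k.
  rewrite {1}hA adjmx_sum; apply: eq_bigr => k _.
  by rewrite !adjmxM trmxCK mulmxA.
have hB' j : (B j)^t* = \sum_k (V' k)^t* *m (A j)^t* *m W' k.
  rewrite {1}hB adjmx_sum; apply: eq_bigr => k _.
  by rewrite !adjmxM trmxCK mulmxA.
have h2 := compression_intertwines hV hV' hA' hB' hr' ri'.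
by move=> k; split => j.
Qed.

End Rigidity.

(** * Unitary equivalence *)

Section FunctionalCalculus.
Variable C : numClosedFieldType.

Definition hermfun (phi : C -> C) n (G : 'M[C]_n) : 'M[C]_n :=
  (spectralmx G)^t* *m diag_mx (map_mx phi (spectral_diag G)) *m spectralmx G.

Lemma spectralmx_adj n (G : 'M[C]_n) :
  spectralmx G *m (spectralmx G)^t* = 1%:M /\ (spectralmx G)^t* *m spectralmx G = 1%:M.
Proof.
have /unitarymxP h := spectral_unitarymx G.
by split => //; apply: mulmx1C.
Qed.

Lemma hermfun_id n (G : 'M[C]_n) : G^t* = G ->
  (spectralmx G)^t* *m diag_mx (spectral_diag G) *m spectralmx G = G.
Proof.
move=> hG; have hh : G \is hermsymmx.
  by apply/is_hermitianmxP; rewrite expr0 scale1r hG.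
have /orthomx_spectralP h := hermitian_normalmx hh.
by rewrite [RHS]h invmx_unitary ?spectral_unitarymx.
Qed.

(** In eigenbases, a nonzero entry of M can only link equal eigenvalues of G and H, on which phi
    agrees. *)
Lemma hermfun_intertwines phi m n (G : 'M[C]_n) (H : 'M[C]_m) (M : 'M[C]_(m, n)) :
  G^t* = G -> H^t* = H -> M *m G = H *m M ->
  M *m hermfun phi G = hermfun phi H *m M.
Proof.
move=> hG hH hM; rewrite /hermfun.
have [U1 U2] := spectralmx_adj G; have [W1 W2] := spectralmx_adj H.
set U := spectralmx G in U1 U2 *; set W := spectralmx H in W1 W2 *.
have [N NE] : exists N, N = W *m M *m U^t* by eexists.
have hN : N *m diag_mx (spectral_diag G) = diag_mx (spectral_diag H) *m N.
  have : W *m (M *m G) *m U^t* = W *m (H *m M) *m U^t* by rewrite hM.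
  rewrite -{1}(hermfun_id hG) -{1}(hermfun_id hH) -/U -/W !mulmxA W1 mul1mx.
  by rewrite -[_ *m U *m U^t*]mulmxA U1 mulmx1 NE !mulmxA.
have hNphi : N *m diag_mx (map_mx phi (spectral_diag G)) =
             diag_mx (map_mx phi (spectral_diag H)) *m N.
  apply/matrixP => i j; have /matrixP/(_ i j) := hN.
  rewrite !mul_mx_diag !mul_diag_mx ![(\matrix_(_, _) _) _ _]mxE.
  rewrite [map_mx _ _ _ _]mxE [map_mx _ _ _ _]mxE => h.
  have [->|n0] := eqVneq (N i j) 0; first by rewrite mul0r mulr0.
  have -> : spectral_diag G 0 j = spectral_diag H 0 i.
    by apply: (mulfI n0); rewrite h mulrC.
  by rewrite mulrC.
have -> : M = W^t* *m N *m U.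
  by rewrite NE !mulmxA W2 mul1mx -mulmxA U2 mulmx1.
rewrite !mulmxA -[_ *m U *m U^t*]mulmxA U1 mulmx1.
rewrite -[_ *m W *m W^t*]mulmxA W1 mulmx1.
by rewrite -[W^t* *m N *m _]mulmxA hNphi mulmxA.
Qed.

(** Since [0^-1 = 0], this is a pseudo-inverse at t = 0, and V times [invsqrt] of V^* V is the
    partial isometry of the polar decomposition even for singular V. *)
Definition invsqrt (t : C) : C := (sqrtC t)^-1.

Lemma invsqrtK t : 0 <= t -> invsqrt t * t * invsqrt t * invsqrt t = invsqrt t.
Proof.
move=> t0; have [->|tn0] := eqVneq t 0; first by rewrite /invsqrt sqrtC0 invr0 !mulr0.
have s0 : sqrtC t != 0 by rewrite sqrtC_eq0.
rewrite /invsqrt -[X in _ * X * _ * _]sqrtCK expr2.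
by rewrite mulrA mulVf// mul1r mulfV// mul1r.
Qed.

Lemma spectral_diag_ge0 n (G : 'M[C]_n) i : psdmx G -> 0 <= spectral_diag G 0 i.
Proof.
move=> hG; have := psdmx_diag_ge0 i (psdmxJ (spectralmx G) hG).
have [U1 U2] := spectralmx_adj G.
rewrite -[X in _ *m X *m _](hermfun_id (psdmx_herm hG)) !mulmxA U1 mul1mx.
by rewrite -mulmxA U1 mulmx1 mxE eqxx.
Qed.

Lemma hermfun_adj n (G : 'M[C]_n) : psdmx G ->
  (hermfun invsqrt G)^t* = hermfun invsqrt G.
Proof.
move=> hG; rewrite /hermfun !adjmxM trmxCK mulmxA; congr (_ *m _ *m _).
rewrite tr_diag_mx map_diag_mx; congr diag_mx; apply/rowP => i; rewrite !mxE /=.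
by rewrite conj_Creal// ger0_real// invr_ge0 sqrtC_ge0 spectral_diag_ge0.
Qed.

Lemma psdmx_adjgram m n (Z : 'M[C]_(m, n)) : psdmx (Z^t* *m Z).
Proof. by rewrite -{2}(trmxCK Z); apply: psdmx_gram. Qed.

Lemma invsqrt_gram n (G : 'M[C]_n) : psdmx G ->
  hermfun invsqrt G *m (G *m hermfun invsqrt G *m hermfun invsqrt G) =
  hermfun invsqrt G.
Proof.
move=> hG; have [U1 U2] := spectralmx_adj G.
rewrite -{2}(hermfun_id (psdmx_herm hG)) /hermfun.
set U := spectralmx G in U1 U2 *; set d := spectral_diag G.
set e := map_mx _ _.
rewrite !mulmxA.
do 3!rewrite -[_ *m U *m U^t*]mulmxA U1 mulmx1.
rewrite -[U^t* *m _ *m _]mulmxA mulmx_diag -[U^t* *m _ *m _]mulmxA mulmx_diag.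
rewrite -[U^t* *m _ *m _]mulmxA mulmx_diag; congr (_ *m diag_mx _ *m _).
apply/rowP => i; rewrite !mxE invsqrtK//; exact: spectral_diag_ge0.
Qed.

Definition partial_isometry m n (V : 'M[C]_(m, n)) := V *m V^t* *m V = V.

Lemma polar_isometry m n (V : 'M[C]_(m, n)) :
  partial_isometry (V *m hermfun invsqrt (V^t* *m V)).
Proof.
have hp := psdmx_adjgram V; rewrite /partial_isometry adjmxM hermfun_adj//.
have comm := hermfun_intertwines invsqrt (psdmx_herm hp) (psdmx_herm hp) erefl.
move: (invsqrt_gram hp) comm; move: (hermfun _ _) => F h comm.
rewrite -!mulmxA; congr (V *m _).
by rewrite -[RHS]h comm !mulmxA.
Qed.

Lemma polar_eq0 m n (V : 'M[C]_(m, n)) :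
  V *m hermfun invsqrt (V^t* *m V) = 0 -> V = 0.
Proof.
have hp := psdmx_adjgram V => h0.
have hG0 : V^t* *m V *m hermfun invsqrt (V^t* *m V) = 0 by rewrite -mulmxA h0 mulmx0.
have [U1 U2] := spectralmx_adj (V^t* *m V).
suff G0 : V^t* *m V = 0.
  by apply/eqP; rewrite -hsnorm_eq0 /hsnorm /hsdot G0 mxtrace0.
move: hp hG0 U1 U2; set G := V^t* *m V => hp.
rewrite -{1}(hermfun_id (psdmx_herm hp)) /hermfun.
set U := spectralmx G => h U1 U2.
suff d0 : spectral_diag G = 0.
  by rewrite -(hermfun_id (psdmx_herm hp)) d0 linear0 mulmx0 mul0mx.
apply/rowP => i; rewrite [RHS]mxE.
have : U *m (U^t* *m diag_mx (spectral_diag G) *m U *m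
  (U^t* *m diag_mx (map_mx invsqrt (spectral_diag G)) *m U)) *m U^t* = 0.
  by rewrite h mulmx0 mul0mx.
rewrite !mulmxA U1 mul1mx.
do 2!rewrite -[_ *m U *m U^t*]mulmxA U1 mulmx1.
rewrite mulmx_diag => /matrixP/(_ i i); rewrite !mxE eqxx mulr1n => /eqP.
by rewrite mulf_eq0 invr_eq0 sqrtC_eq0 orbb => /eqP.
Qed.

Lemma projection_contract n m (E : 'M[C]_n) (v : 'M[C]_(n, m)) :
  E^t* = E -> E *m E = E ->
  hsnorm v = hsnorm (E *m v) + hsnorm (v - E *m v).
Proof.
move=> h1 h2; rewrite -{1}[v](subrK (E *m v)) [LHS]hsnormD.
have -> : hsdot (E *m v) (v - E *m v) = 0.
  by rewrite hsdotDr hsdotNr hsdot_mulr h1 mulmxA h2 subrr.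
have -> : hsdot (v - E *m v) (E *m v) = 0.
  rewrite hsdotDl hsdotNl hsdot_mulr [X in _ - X]hsdot_mulr.
  by rewrite !h1 mulmxA h2 subrr.
by rewrite !addr0 addrC.
Qed.

End FunctionalCalculus.

Arguments invsqrt {C} t.

Section Equivalence.
Variables (C : numClosedFieldType) (g a' a : nat).
Variables A B : 'I_g -> 'M[C]_(a', a).

(** With the adjoint relation included, V^* V and W^* W intertwine A with itself, and so do
    functions of them: polar parts stay in the class. *)
Definition intertwiner (V : 'M[C]_a) (W : 'M[C]_a') :=
  (forall j, B j *m V = W *m A j) /\ (forall j, (B j)^t* *m W = V *m (A j)^t*).

Lemma intertwiner_adj V W : intertwiner V W ->
  (forall j, A j *m V^t* = W^t* *m B j) /\ (forall j, (A j)^t* *m W^t* = V^t* *m (B j)^t*).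
Proof.
move=> [h1 h2]; split => j.
  by apply: (can_inj (@trmxCK _ _ _)); rewrite !adjmxM !trmxCK h2.
by rewrite -!adjmxM h1.
Qed.

Lemma intertwinerD V W V' W' : intertwiner V W -> intertwiner V' W' ->
  intertwiner (V + V') (W + W').
Proof.
move=> [h1 h2] [h3 h4]; split=> j.
  by rewrite mulmxDr mulmxDl h1 h3.
by rewrite mulmxDr mulmxDl h2 h4.
Qed.

Lemma intertwiner_gram V W : intertwiner V W ->
  (forall j, A j *m (V^t* *m V) = (W^t* *m W) *m A j) /\
  (forall j, (A j)^t* *m (W^t* *m W) = (V^t* *m V) *m (A j)^t*).
Proof.
move=> h; have [h1 h2] := h; have [h3 h4] := intertwiner_adj h; split => j.
  by rewrite mulmxA h3 -mulmxA h1 mulmxA.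
by rewrite mulmxA h4 -mulmxA h2 mulmxA.
Qed.

Lemma intertwiner_cogram V W : intertwiner V W ->
  (forall j, B j *m (V *m V^t*) = (W *m W^t*) *m B j) /\
  (forall j, (B j)^t* *m (W *m W^t*) = (V *m V^t*) *m (B j)^t*).
Proof.
move=> h; have [h1 h2] := h; have [h3 h4] := intertwiner_adj h; split => j.
  by rewrite mulmxA h1 -mulmxA h3 mulmxA.
by rewrite mulmxA h2 -mulmxA h4 mulmxA.
Qed.

Lemma intertwiner_polar V W : intertwiner V W ->
  intertwiner (V *m hermfun invsqrt (V^t* *m V)) (W *m hermfun invsqrt (W^t* *m W)).
Proof.
move=> h; have [h1 h2] := h; have [g1 g2] := intertwiner_gram h.
have hV := psdmx_herm (psdmx_adjgram V); have hW := psdmx_herm (psdmx_adjgram W).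
split => j.
  by rewrite mulmxA h1 -mulmxA (hermfun_intertwines _ hV hW (g1 j)) mulmxA.
by rewrite mulmxA h2 -mulmxA (hermfun_intertwines _ hW hV (g2 j)) mulmxA.
Qed.

(* A partial-isometric intertwiner of maximal rank is unitary: otherwise the
   part of [A] on which it vanishes still carries the norm (by minimality), and
   some [V k] then provides an intertwiner orthogonal to it. *)
Lemma unitary_intertwiner (I : finType) (W : I -> 'M[C]_a') (V : I -> 'M[C]_a) :
  norm_minimal A -> (0 < a' * a)%N ->
  isometries W -> isometries V ->
  (forall j, A j = \sum_k (W k)^t* *m B j *m V k) ->
  (forall k, intertwiner (V k) (W k)) ->
  exists V0 W0, [/\ intertwiner V0 W0, V0^t* *m V0 = 1%:M & W0^t* *m W0 = 1%:M].
Proof.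
move=> hmin a0 hW hV hA hVW.
pose P k := exists V0 W0, [/\ intertwiner V0 W0, partial_isometry V0,
  partial_isometry W0 & (\rank (V0^t* *m V0) + \rank (W0^t* *m W0))%N = k].
have [k [V0 [W0 [hi pV pW hk]]] hmax] : exists2 k, P k & forall m, P m -> (m <= k)%N.
  apply: (exists_maximal_nat (N := (a + a')%N)).
    exists 0%N, 0, 0; rewrite !mulmx0 !mxrank0.
    by split; rewrite /partial_isometry ?mulmx0 //; split => j; rewrite !mulmx0 mul0mx.
  by move=> m [r [r' [_ _ _ <-]]]; rewrite leq_add ?rank_leq_row.
pose E := V0^t* *m V0; pose E' := W0^t* *m W0.
have Eadj : E^t* = E by rewrite /E adjmxM trmxCK.
have E'adj : E'^t* = E' by rewrite /E' adjmxM trmxCK.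
have VE : V0 *m E = V0 by rewrite /E mulmxA.
have WE' : W0 *m E' = W0 by rewrite /E' mulmxA.
have Eid : E *m E = E by rewrite {1}/E -mulmxA VE.
have E'id : E' *m E' = E' by rewrite {1}/E' -mulmxA WE'.
have [AE _] := intertwiner_gram hi.
have Epsd : psdmx E by apply: psdmx_adjgram.
have E'psd : psdmx E' by apply: psdmx_adjgram.
(* If every [V k] sends the range of 1 - E into the range of V0, then A over 1 - E is dominated by B
   over the range of V0, which is a copy of A over E. The part over E thus carries all norms, and
   minimality makes E and E' identities. *)
suff hz : forall k, (1%:M - V0 *m V0^t*) *m V k *m (1%:M - E) = 0.
  have [Q hQ QP] := support_isometry Epsd.
  have [Q' hQ' QP'] := support_isometry E'psd.
  have hQE : Q *m (Q^t* *m E) = E by apply: QP => x; apply: psdmx_form0.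
  have hQE' : Q' *m (Q'^t* *m E') = E' by apply: QP' => x; apply: psdmx_form0.
  have : (a' * a <= \rank E' * \rank E)%N.
    apply: (hmin _ _ (fun j => Q'^t* *m A j *m Q)) => n X c.
    split; first exact: gain_le_compress.
    move=> hc.
    have evE v : ev A X (E *m v) = E' *m ev A X v.
      by rewrite /ev mulmx_sumr; apply: eq_bigr => j _; rewrite mulmxA AE !mulmxA.
    have c1 v : hsnorm (ev A X (E *m v)) <= c * hsnorm (E *m v).
      have hv : E *m v = Q *m (Q^t* *m (E *m v)) by rewrite -{1}hQE !mulmxA.
      have hu : ev A X (E *m v) = Q' *m (Q'^t* *m ev A X (E *m v)).
        by rewrite evE -{1}hQE' !mulmxA.
      rewrite hu (hsnorm_isometry _ hQ') [in leRHS]hv (hsnorm_isometry _ hQ).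
      have := hc (Q^t* *m (E *m v)).
      suff -> : ev (fun j => Q'^t* *m A j *m Q) X (Q^t* *m (E *m v)) =
        Q'^t* *m ev A X (E *m v) by [].
      rewrite [in RHS]hv /ev mulmx_sumr; apply: eq_bigr => j _.
      by rewrite !mulmxA.
    have nV m (v : 'M[C]_(a, m)) : hsnorm (V0 *m v) = hsnorm (E *m v).
      rewrite /hsnorm hsdot_mulr [in RHS]hsdot_mulr Eadj mulmxA -/E.
      by rewrite mulmxA Eid.
    have nW m (v : 'M[C]_(a', m)) : hsnorm (W0 *m v) <= hsnorm v.
      have -> : hsnorm (W0 *m v) = hsnorm (E' *m v).
        by rewrite /hsnorm hsdot_mulr [in RHS]hsdot_mulr E'adj mulmxA -/E' mulmxA E'id.
      by rewrite [leRHS](projection_contract v E'adj E'id) lerDl hsnorm_ge0.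
    have c3 v : hsnorm (ev B X (V0 *m v)) <= c * hsnorm (V0 *m v).
      have -> : ev B X (V0 *m v) = W0 *m ev A X (E *m v).
        rewrite evE mulmxA WE' /ev mulmx_sumr; apply: eq_bigr => j _.
        by rewrite mulmxA hi.1 !mulmxA.
      by rewrite nV; apply: (le_trans (nW _ _)); apply: c1.
    have c2 v : hsnorm (ev A X ((1%:M - E) *m v)) <= c * hsnorm ((1%:M - E) *m v).
      set w := _ *m v.
      have hAw : ev A X w = \sum_k (W k)^t* *m ev B X (V k *m w).
        under eq_bigr => i _ do rewrite /ev mulmx_sumr.
        rewrite exchange_big; apply: eq_bigr => j _ /=; rewrite {1}hA !mulmx_suml.
        by apply: eq_bigr => i _; rewrite !mulmxA.
      apply: (le_trans (compression_le hW hAw)).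
      rewrite -(isometries_norm w hV) mulr_sumr; apply: ler_sum => i _.
      have -> : V i *m w = V0 *m (V0^t* *m (V i *m w)).
        apply/eqP; rewrite -subr_eq0 mulmxA -{1}[V i *m w]mul1mx -mulmxBl.
        by rewrite /w !mulmxA hz mul0mx.
      exact: c3.
    move=> v.
    rewrite (projection_contract v Eadj Eid).
    have -> : v - E *m v = (1%:M - E) *m v by rewrite mulmxBl mul1mx.
    rewrite mulrDr (projection_contract (ev A X v) E'adj E'id) -evE.
    apply: lerD => //; suff -> : ev A X v - ev A X (E *m v) = ev A X ((1%:M - E) *m v) by [].
    rewrite mulmxBl mul1mx /ev -sumrB; apply: eq_bigr => j _.
    by rewrite mulmxBr mulmxBl.
  move=> /(leq_mul_eq (rank_leq_row _) (rank_leq_row _) a0)[e' e].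
  have full m (F : 'M[C]_m) : F *m F = F -> \rank F = m -> F = 1%:M.
    move=> hF hr; have hu : F \in unitmx by rewrite -row_free_unit /row_free hr.
    by apply: (can_inj (mulmxK hu)); rewrite mul1mx.
  by exists V0, W0; split => //; apply: full.
move=> i; apply/eqP/negP => /negP hne.
have [hB1 hB2] := intertwiner_cogram hi; have [hA1 hA2] := intertwiner_gram hi.
set V' := _ *m _ *m _ in hne.
pose W' := (1%:M - W0 *m W0^t*) *m W i *m (1%:M - E').
have hi' : intertwiner V' W'.
  have [h1 h2] := hVW i; split => j; rewrite /V' /W' !mulmxA.
    rewrite [B j *m (_ - _)]mulmxBr mulmx1 hB1 -{1}[B j]mul1mx -mulmxBl -[_ *m B j *m _]mulmxA h1.
    rewrite -!mulmxA; congr (_ *m (_ *m _)).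
    by rewrite mulmxBr mulmxBl mulmx1 mul1mx AE.
  rewrite [_^t* *m (_ - _)]mulmxBr mulmx1 hB2 -{1}[(B j)^t*]mul1mx -mulmxBl.
  rewrite -[_ *m (B j)^t* *m _]mulmxA h2.
  rewrite -!mulmxA; congr (_ *m (_ *m _)).
  by rewrite mulmxBr mulmxBl mulmx1 mul1mx hA2.
have hip := intertwiner_polar hi'.
(* Cutting [Yi] down on both sides makes its polar part Z orthogonal to Y0 in domain and range, so
   that Y0 + Z is again a partial isometry. *)
have ortho m (Y0 Yi : 'M[C]_m) (Y' := (1%:M - Y0 *m Y0^t*) *m Yi *m (1%:M - Y0^t* *m Y0))
    (Z := Y' *m hermfun invsqrt (Y'^t* *m Y')) : partial_isometry Y0 ->
    [/\ Y0^t* *m Z = 0, Y0 *m Z^t* = 0, partial_isometry (Y0 + Z) &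
    (Y0 + Z)^t* *m (Y0 + Z) = Y0^t* *m Y0 + Z^t* *m Z].
  move=> pY.
  have pY' : Y0^t* *m Y0 *m Y0^t* = Y0^t*.
    by rewrite -[in RHS]pY !adjmxM trmxCK mulmxA.
  have z1 : Y0^t* *m Y' = 0.
    by rewrite /Y' !mulmxA [Y0^t* *m (_ - _)]mulmxBr mulmx1 mulmxA pY' subrr !mul0mx.
  have z2 : Y' *m Y0^t* = 0.
    by rewrite /Y' -!mulmxA [(_ - _) *m Y0^t*]mulmxBl mul1mx pY' subrr !mulmx0.
  have hZ : Z = hermfun invsqrt (Y' *m Y'^t*) *m Y'.
    exact: (hermfun_intertwines invsqrt (psdmx_herm (psdmx_adjgram Y'))
      (psdmx_herm (psdmx_gram Y')) (mulmxA Y' _ _)).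
  have o1 : Y0^t* *m Z = 0 by rewrite /Z mulmxA z1 mul0mx.
  have o2 : Y0 *m Z^t* = 0.
    have : Z *m Y0^t* = 0 by rewrite hZ -mulmxA z2 mulmx0.
    by move/(congr1 (fun M => M^t*)); rewrite adjmxM trmxCK adjmx0.
  have o3 : Z^t* *m Y0 = 0 by rewrite -[Y0]trmxCK -adjmxM o1 adjmx0.
  have pZ : partial_isometry Z by apply: polar_isometry.
  have hg : (Y0 + Z)^t* *m (Y0 + Z) = Y0^t* *m Y0 + Z^t* *m Z.
    by rewrite adjmxD mulmxDl !mulmxDr o1 o3 addr0 add0r.
  clearbody Z; split => //; rewrite /partial_isometry -mulmxA hg mulmxDl !mulmxDr !mulmxA.
  rewrite pY pZ o2 mul0mx addr0.
  suff -> : Z *m Y0^t* = 0 by rewrite mul0mx add0r.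
  by rewrite -[Z]trmxCK -adjmxM o2 adjmx0.
have [oV1 oV2 pVs gV] := ortho _ V0 (V i) pV.
have [oW1 oW2 pWs gW] := ortho _ W0 (W i) pW.
have hle := hmax _ (ex_intro _ _ (ex_intro _ _ (And4 (intertwinerD hi hip) pVs pWs erefl))).
rewrite -hk {}gV {}gW in hle.
have r1 := psdmx_rankD E'psd (psdmx_adjgram (W' *m hermfun invsqrt (W'^t* *m W'))).
have r2 : (\rank (E + (V' *m hermfun invsqrt (V'^t* *m V'))^t* *m
    (V' *m hermfun invsqrt (V'^t* *m V')))%R <= \rank E)%N.
  by rewrite -(leq_add2r (\rank E')) (leq_trans _ hle)// leq_add2l.
set Z := V' *m _ in oV1 oV2 r2 *.
have hZ : partial_isometry Z by apply: polar_isometry.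
case/eqP: hne; apply: polar_eq0; rewrite -/Z.
apply/eqP; rewrite -hsnorm_eq0; apply/eqP; rewrite /hsnorm /hsdot.
suff -> : Z^t* *m Z = 0 by rewrite mxtrace0.
clearbody Z.
have ZZ : Z^t* *m Z *m (Z^t* *m Z) = Z^t* *m Z.
  by rewrite -mulmxA [Z *m (_ *m _)]mulmxA hZ.
(* The rows of Z^* Z lie in the kernel of E, hence by [r2] in that of Z^* Z: this projection squares
   to zero. *)
rewrite -ZZ; apply/row_matrixP => l; rewrite row0 row_mul.
apply: (psdmx_rankD_eq Epsd (psdmx_adjgram Z) r2).
rewrite -row_mul /E mulmxA -[Z^t* *m Z *m _]mulmxA.
have -> : Z *m V0^t* = 0 by rewrite -[Z]trmxCK -adjmxM oV2 adjmx0.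
by rewrite mulmx0 mul0mx row0.
Qed.

End Equivalence.

(** * Semidefinite duality *)

Local Open Scope classical_set_scope.
Local Open Scope ring_scope.

Lemma continuous_sum (R : realType) (U : topologicalType) (J : Type) (r : seq J)
    (F : J -> U -> R) :
  (forall j, continuous (F j)) -> continuous (fun x => \sum_(j <- r) F j x).
Proof.
move=> hF; elim: r => [|j r ih] x.
  by under eq_fun do rewrite big_nil; apply: cvg_cst.
by under eq_fun do rewrite big_cons; apply: cvgD; [apply: hF|apply: ih].
Qed.

Lemma linear_functional_continuous (R : realType) M (T : 'rV[R]_M -> R) :
  (forall a x y, T (a *: x + y) = a * T x + T y) -> continuous T.
Proof.
move=> hT.
have T0 : T 0 = 0.
  have := hT 1 0 0; rewrite scaler0 addr0 mul1r => /eqP.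
  by rewrite -subr_eq subrr eq_sym => /eqP.
have hs (r : seq 'I_M) (F : 'I_M -> 'rV[R]_M) (c : 'I_M -> R) :
    T (\sum_(i <- r) c i *: F i) = \sum_(i <- r) c i * T (F i).
  elim: r => [|i r ih]; first by rewrite !big_nil.
  by rewrite !big_cons hT ih.
have -> : T = (fun x => \sum_(k < M) x 0 k * T (delta_mx 0 k)).
  by apply/funext => x; rewrite {1}[x]row_sum_delta hs.
apply: continuous_sum => k x.
have h1 := @coord_continuous R 1 M 0 k x.
exact: (cvgM h1 (cvg_cst _)).
Qed.

(* [z0] is the point of the cone whose image is closest to [t]; the separating
   functional is the residual [T z0 - t]. *)
Lemma cone_alternative (R : realType) M (I : finType) (K : set 'rV[R]_M)
    (T : I -> 'rV[R]_M -> R) (t b : I -> R) :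
  closed K -> K 0 -> (forall x y, K x -> K y -> K (x + y)) ->
  (forall a x, 0 <= a -> K x -> K (a *: x)) ->
  (forall i a x y, T i (a *: x + y) = a * T i x + T i y) ->
  (forall x, K x -> `|x| <= \sum_i b i * T i x) ->
  (exists2 x, K x & forall i, T i x = t i) \/
  (exists2 y : I -> R, forall x, K x -> 0 <= \sum_i y i * T i x &
     \sum_i y i * t i < 0).
Proof.
move=> Kcl K0 KD KZ Tlin Tb.
have Tcont i : continuous (T i) by apply: linear_functional_continuous.
pose h x := \sum_i (T i x - t i) ^+ 2.
have hcont : continuous h.
  apply: continuous_sum => i x.
  have h1 : (fun z => T i z - t i) z @[z --> x] --> T i x - t i.
    exact: (cvgB (Tcont i x) (cvg_cst _)).
  have -> : (fun z => (T i z - t i) ^+ 2) = (fun z => (T i z - t i) * (T i z - t i)).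
    by apply/funext => z; rewrite expr2.
  exact: (cvgM h1 h1).
pose D := K `&` (h @^-1` [set y | y <= h 0]).
have Dcl : closed D.
  by apply: closedI => //; apply: (closed_comp (f := h)) => [x _|]; [apply: hcont|apply: closed_le].
have h0 : 0 <= h 0 by apply: sumr_ge0 => i _; rewrite sqr_ge0.
have Dbd : bounded_set D.
  (* [h 0 + 1] bounds the square root of [h 0], and hence each residual on the sublevel set. *)
  exists (\sum_i `|b i| * (h 0 + 1 + `|t i|)); split; first exact: num_real.
  move=> m hm x [Kx hx] /=; apply: le_trans (ltW hm); apply: le_trans (Tb _ Kx) _.
  apply: ler_sum => i _; apply: le_trans (ler_norm _) _; rewrite normrM.
  apply: ler_wpM2l => //; rewrite -[T i x](subrK (t i)).
  apply: le_trans (ler_normD _ _) _; rewrite lerD2r.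
  have h1 : (T i x - t i) ^+ 2 <= h 0.
    apply: le_trans hx; rewrite /h (bigD1 i)//= lerDl.
    by apply: sumr_ge0 => j _; rewrite sqr_ge0.
  rewrite -(@ler_pXn2r _ 2)// ?nnegrE ?addr_ge0// real_normK ?num_real//.
  by apply: le_trans h1 _; nra.
have [z0 /set_mem[Kz0 hz0] hmin] : exists2 z, z \in D & forall x, x \in D -> h z <= h x.
  apply: EVT_min_rV; first by exists 0; split => //=.
    exact: bounded_closed_compact.
  exact: continuous_subspaceT.
have hminK x : K x -> h z0 <= h x.
  move=> Kx; have [hx|hx] := leP (h x) (h 0); first by apply/hmin/mem_set; split.
  exact: le_trans hz0 (ltW hx).
pose y i := T i z0 - t i.
have hvar e x : K (z0 + e *: x) -> 0 <= e * (\sum_i y i * T i x) *+ 2 + e ^+ 2 * \sum_i T i x ^+ 2.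
  move=> /hminK; rewrite -subr_ge0; congr (_ <= _); rewrite /h -sumrB.
  rewrite !mulr_sumr -sumrMnl -big_split; apply: eq_bigr => i _ /=.
  by rewrite [z0 + _]addrC Tlin /y; ring.
have hvar0 s x : s ^+ 2 = 1 -> (forall e, 0 <= e <= 1 -> K (z0 + (e * s) *: x)) ->
    0 <= s * (\sum_i y i * T i x).
  move=> s1 hx; rewrite leNgt; apply/negP => hlt.
  set c := s * _ in hlt; pose q := \sum_i T i x ^+ 2.
  have q0 : 0 <= q by apply: sumr_ge0 => i _; rewrite sqr_ge0.
  (* For c < 0 this gives 0 < e <= 1 and e q <= - c, so the variation 2 c + e q is at most c, hence
     negative. *)
  pose e := (- c) / (1 - c + q).
  have d0 : 0 < 1 - c + q by rewrite ltr_wpDr// subr_gt0 (lt_trans hlt).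
  have e0 : 0 < e by rewrite divr_gt0// oppr_gt0.
  have e1 : e <= 1 by rewrite ler_pdivrMr// mul1r; lra.
  have := hvar (e * s) x (hx e _); rewrite (ltW e0) e1 => /(_ isT).
  rewrite exprMn s1 mulr1 -mulrA -/c -/q => h1.
  have : 0 <= e * (c *+ 2 + e * q) by move: h1; rewrite mulrDr mulrnAr expr2 mulrA.
  rewrite pmulr_rge0// => h2.
  have h3 : e * (1 - c + q) = - c by rewrite /e divfK// gt_eqF.
  have : e * q <= - c by rewrite -h3 ler_pM2l//; lra.
  by rewrite mulr2n in h2 *; lra.
have ypos x : K x -> 0 <= \sum_i y i * T i x.
  move=> Kx; rewrite -[X in _ <= X]mul1r; apply: hvar0; rewrite ?expr1n// => e /andP[e0 _].
  by rewrite mulr1; apply: KD => //; apply: KZ.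
(* Variation towards the apex: z0 - e z0 stays in the cone because e <= 1. *)
have yz0 : \sum_i y i * T i z0 <= 0.
  rewrite -oppr_ge0 -mulN1r; apply: hvar0; first by rewrite sqrrN expr1n.
  move=> e /andP[e0 e1]; rewrite mulrN1 -[X in X + _]scale1r -scalerDl.
  by apply: KZ => //; rewrite subr_ge0.
have [hz|hnz] := eqVneq (h z0) 0.
  left; exists z0 => // i; apply/eqP; rewrite -subr_eq0 -sqrf_eq0.
  move/eqP: hz; rewrite psumr_eq0 => [/allP/(_ i (mem_index_enum _))//|j _].
  exact: sqr_ge0.
right; exists y => //; rewrite -subr_gt0 sub0r.
have : 0 < h z0.
  by rewrite lt_def hnz; apply: sumr_ge0 => i _; apply: sqr_ge0.
suff -> : h z0 = \sum_i y i * T i z0 - \sum_i y i * t i.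
  by move=> h1; apply: lt_le_trans h1 _; rewrite gerDr.
rewrite -sumrB; apply: eq_bigr => i _; rewrite /y; ring.
Qed.

(* [z + z^*] stands for the real part of [z], up to a factor 2. *)
Definition semidefinite_farkas (C : numClosedFieldType) :=
  forall N (J : finType) (Q : J -> 'M[C]_N) (t c : J -> C),
  \sum_i c i *: Q i = 1%:M ->
  (exists2 G, psdmx G & forall i, \tr (Q i *m G) = t i) \/
  (exists2 y : J -> C,
     forall G, psdmx G ->
       0 <= \sum_i y i * \tr (Q i *m G) + (\sum_i y i * \tr (Q i *m G))^* &
     \sum_i y i * t i + (\sum_i y i * t i)^* < 0).

(** * Semidefinite Farkas alternative over the complex numbers *)

Section RealCoordinates.
Variable R : realType.
Local Notation C := (Cplx R).
Local Notation Re := (@complex.Re R).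
Local Notation Im := (@complex.Im R).

Definition ofreal (x : R) : C := Complex x 0.

Lemma ReD (x y : C) : Re (x + y) = Re x + Re y.
Proof. by case: x y => [? ?] [? ?]. Qed.

Lemma ImD (x y : C) : Im (x + y) = Im x + Im y.
Proof. by case: x y => [? ?] [? ?]. Qed.

Lemma ReM (x y : C) : Re (x * y) = Re x * Re y - Im x * Im y.
Proof. by case: x y => [? ?] [? ?]. Qed.

Lemma Re_ofrealM a (x : C) : Re (ofreal a * x) = a * Re x.
Proof. by case: x => c d; rewrite ReM /= mul0r subr0. Qed.

Lemma Im_ofrealM a (x : C) : Im (ofreal a * x) = a * Im x.
Proof. by case: x => c d; rewrite /= mul0r addr0. Qed.

Lemma Re_sum (I : finType) (F : I -> C) : Re (\sum_i F i) = \sum_i Re (F i).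
Proof. by apply: (big_morph Re ReD). Qed.

Lemma cplx_ge0 (z : C) : (0 <= z) = (Im z == 0) && (0 <= Re z).
Proof. exact: lecE. Qed.

Lemma cplx_gt0 (z : C) : (0 < z) = (Im z == 0) && (0 < Re z).
Proof. exact: ltcE. Qed.

Lemma cplx_addconj (z : C) : z + z^* = ofreal (Re z *+ 2).
Proof. by case: z => a b; congr Complex; rewrite ?mulr2n// subrr. Qed.

Lemma Re_le_norm (z : C) (b : C) : `|z| <= b -> `|Re z| <= Re b.
Proof.
move=> hz; have := le_trans (normc_ge_Re z) hz.
by rewrite lecE => /andP[_].
Qed.

Lemma Im_le_norm (z : C) (b : C) : `|z| <= b -> `|Im z| <= Re b.
Proof.
move=> hz; have -> : Im z = Re (- (Complex 0 1 : C) * z).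
  by case: z hz => x y _ /=; rewrite oppr0 mul0r sub0r mulN1r opprK.
apply: Re_le_norm; rewrite normrM normrN.
suff -> : `|Complex 0 1 : C| = 1 by rewrite mul1r.
by rewrite [LHS]normc_def /= expr0n /= expr1n add0r sqrtr1.
Qed.

Section Coordinates.
Variable N : nat.

Definition cmx (z : 'rV[R]_(N * N + N * N)) : 'M[C]_N :=
  \matrix_(i, j) (Complex (lsubmx z 0 (mxvec_index i j)) (rsubmx z 0 (mxvec_index i j)) : C).

Lemma cmx_linear a x y : cmx (a *: x + y) = ofreal a *: cmx x + cmx y.
Proof.
apply/matrixP => i j; rewrite !mxE /ofreal; apply/eqP.
by rewrite eq_complex /= !mul0r subr0 addr0 !eqxx.
Qed.

Lemma cmx_surj G : exists z, cmx z = G.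
Proof.
exists (row_mx (mxvec (map_mx Re G)) (mxvec (map_mx Im G))).
apply/matrixP => i j; rewrite mxE row_mxKl row_mxKr !mxvecE !mxE.
by case: (G i j).
Qed.

(** With G = Z Z^*, the inequality 2xy <= x^2 + y^2 gives 2|G_ij| <= G_ii + G_jj. Each diagonal
    entry is bounded by the trace separately, as i = j is allowed. *)
Lemma psdmx_entry_le (G : 'M[C]_N) i j : psdmx G -> `|G i j| *+ 2 <= (\tr G) *+ 2.
Proof.
move=> hG; have [Z GZ] := psdmx_sqrt hG.
have Gd k : G k k = \sum_l `|Z k l| ^+ 2.
  by rewrite GZ mxE; apply: eq_bigr => l _; rewrite !mxE normCK.
have Gtr k : G k k <= \tr G.
  rewrite /mxtrace (bigD1 k)//= lerDl sumr_ge0// => l _.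
  exact: psdmx_diag_ge0.
apply: (@le_trans _ _ (G i i + G j j)); last by rewrite mulr2n lerD.
rewrite !Gd -big_split /= -mulr_natl.
apply: (@le_trans _ _ (2%:R * \sum_l `|Z i l| * `|Z j l|)).
  rewrite ler_pM2l ?ltr0n// GZ mxE; apply: (le_trans (ler_norm_sum _ _ _)).
  apply: ler_sum => l _; rewrite !mxE normrM.
  by rewrite [X in _ * X]norm_conjC.
rewrite mulr_sumr; apply: ler_sum => l _.
rewrite mulr_natl -subr_ge0 addrAC -sqrrB.
by rewrite real_exprn_even_ge0// rpredB.
Qed.

Lemma cmx_norm_le z : psdmx (cmx z) -> `|z| <= Re (\tr (cmx z)).
Proof.
move=> hG; have h i j : `|cmx z i j| <= \tr (cmx z).
  by have := psdmx_entry_le i j hG; rewrite ler_pMn2r.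
rewrite [leLHS]/Num.norm /= mx_normrE; apply/bigmax_leP; split.
  have : 0 <= \tr (cmx z) by apply: sumr_ge0 => i _; apply: psdmx_diag_ge0.
  by rewrite cplx_ge0 => /andP[].
move=> [i k] _ /=; rewrite ord1.
rewrite -[z]hsubmxK; case: (splitP k) => k' hk'.
  have -> : k = lshift _ k' by apply: val_inj.
  case/mxvec_indexP: k' hk' => p q _; rewrite row_mxEl hsubmxK.
  by have := Re_le_norm (h p q); rewrite [cmx _ _ _]mxE.
have -> : k = rshift _ k' by apply: val_inj.
case/mxvec_indexP: k' hk' => p q _; rewrite row_mxEr hsubmxK.
by have := Im_le_norm (h p q); rewrite [cmx _ _ _]mxE.
Qed.

End Coordinates.

(** The cone alternative in real coordinates, each constraint splitting into its real and imaginary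
    parts. The combination of the [Q i] equal to 1 expresses the trace of G through the constraints,
    and the trace bounds all entries of a semidefinite G. *)
Lemma cplx_semidefinite_farkas : semidefinite_farkas (Cplx R).
Proof.
move=> N J Q t c hc.
pose T (p : J * bool) (z : 'rV[R]_(N * N + N * N)) : R :=
  let w := \tr (Q p.1 *m cmx z) in if p.2 then Im w else Re w.
pose K : set 'rV[R]_(N * N + N * N) := [set z | psdmx (cmx z)].
have trlin i a x y : \tr (Q i *m cmx (a *: x + y)) =
    ofreal a * \tr (Q i *m cmx x) + \tr (Q i *m cmx y).
  by rewrite cmx_linear mulmxDr -scalemxAr mxtraceD mxtraceZ.
have Tlin p a x y : T p (a *: x + y) = a * T p x + T p y.
  rewrite /T; case: p => i [] /=; rewrite trlin.
    by rewrite ImD Im_ofrealM.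
  by rewrite ReD Re_ofrealM.
have formlin (v : 'rV[C]_N) a x y : (v *m cmx (a *: x + y) *m v^t*) 0 0 =
    ofreal a * (v *m cmx x *m v^t*) 0 0 + (v *m cmx y *m v^t*) 0 0.
  by rewrite cmx_linear mulmxDr mulmxDl -scalemxAr -scalemxAl mxE [X in X + _]mxE.
pose form (v : 'rV[C]_N) z := (v *m cmx z *m v^t*) 0 0.
have Rlin v a x y : Re (form v (a *: x + y)) = a * Re (form v x) + Re (form v y).
  by rewrite -Re_ofrealM -ReD; congr complex.Re; exact: formlin.
have Ilin v a x y : Im (form v (a *: x + y)) = a * Im (form v x) + Im (form v y).
  by rewrite -Im_ofrealM -ImD; congr complex.Im; exact: formlin.
have Kcl : closed K.
  have -> : K = \bigcap_(v in [set: 'rV[C]_N])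
      ([set z | Im (form v z) = 0] `&`
       [set z | 0 <= Re (form v z)]).
    apply/seteqP; split => z /=.
      by move=> hz v _; have := hz v; rewrite cplx_ge0 => /andP[/eqP].
    by move=> hz v; have [] := hz v I; rewrite cplx_ge0 => /= -> ->; rewrite eqxx.
  apply: closed_bigI => v _; apply: closedI.
    apply: (closed_comp (f := fun z => Im (form v z)) (D := [set 0])).
      by move=> z _; apply: linear_functional_continuous; apply: Ilin.
    exact: closed_eq.
  apply: (closed_comp (f := fun z => Re (form v z))
    (D := [set y | 0 <= y])); last exact: closed_ge.
  by move=> z _; apply: linear_functional_continuous; apply: Rlin.
have cmx0 : cmx 0 = 0 :> 'M[C]_N.
  by apply/matrixP => i j; rewrite !mxE; apply/eqP; rewrite eq_complex /= !eqxx.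
have K0 : K 0 by move=> v; rewrite cmx0 mulmx0 mul0mx mxE.
have KZ a x : 0 <= a -> K x -> K (a *: x).
  move=> a0 hx v; rewrite -[a *: x]addr0 formlin cmx0 mulmx0 mul0mx [X in _ + X]mxE addr0.
  by rewrite mulr_ge0// cplx_ge0 eqxx.
have KD x y : K x -> K y -> K (x + y).
  move=> hx hy v; rewrite -[x]scale1r formlin; apply: addr_ge0 => //.
  by rewrite mulr_ge0// cplx_ge0 /= eqxx ler01.
pose tr (p : J * bool) : R := if p.2 then Im (t p.1) else Re (t p.1).
pose b (p : J * bool) : R := if p.2 then - Im (c p.1) else Re (c p.1).
have sum_pair (F : J * bool -> R) : \sum_p F p = \sum_i (F (i, true) + F (i, false)).
  transitivity (\sum_i \sum_e F (i, e)); last by apply: eq_bigr => i _; rewrite big_bool.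
  by rewrite pair_bigA; apply: eq_bigr => -[].
have Tb z : K z -> `|z| <= \sum_p b p * T p z.
  move=> hz; apply: (le_trans (cmx_norm_le hz)).
  have -> : \tr (cmx z) = \sum_i c i * \tr (Q i *m cmx z).
    rewrite -[X in \tr X]mul1mx -hc mulmx_suml raddf_sum; apply: eq_bigr => i _ /=.
    by rewrite -scalemxAl mxtraceZ.
  rewrite Re_sum sum_pair; apply: ler_sum => i _; rewrite ReM /b /T /=.
  by rewrite mulNr addrC.
have [[z hz htz]|[y hy hyt]] := cone_alternative tr Kcl K0 KD KZ Tlin Tb.
  left; exists (cmx z) => // i; have := htz (i, true); have := htz (i, false).
  rewrite /T /tr /=; case: (\tr _) => p q /= -> ->.
  by case: (t i).
(* The minus sign makes Re (yc w) the real pairing of y with (Re w, Im w). *)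
right; pose yc i : C := Complex (y (i, false)) (- y (i, true)).
have ycE (w : J -> C) : Re (\sum_i yc i * w i) =
    \sum_p y p * (if p.2 then Im (w p.1) else Re (w p.1)).
  rewrite Re_sum sum_pair; apply: eq_bigr => i _; rewrite ReM /=.
  by rewrite mulNr opprK addrC.
exists yc.
  move=> G hG; have [z hz] := cmx_surj G.
  rewrite cplx_addconj cplx_ge0 eqxx /= pmulrn_lge0// ycE.
  by rewrite -hz; apply: hy; rewrite /K /= hz.
rewrite -oppr_gt0 cplx_addconj.
suff h : Re (\sum_i yc i * t i) < 0.
  by rewrite cplx_gt0 /= oppr0 eqxx oppr_gt0 pmulrn_llt0.
by rewrite ycE.
Qed.

End RealCoordinates.

(** * Compressions from domination *)

Lemma mxtrace_delta_mul (K : nzRingType) N (p q : 'I_N) (G : 'M[K]_N) :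
  \tr (delta_mx p q *m G) = G q p.
Proof.
rewrite /mxtrace (bigD1 p)//= [X in _ + X]big1 ?addr0; last first.
  move=> i /negbTE hi; rewrite mxE big1// => k _.
  by rewrite mxE hi mul0r.
rewrite mxE (bigD1 q)//= big1 ?addr0; last first.
  by move=> k /negbTE hk; rewrite mxE hk andbF mul0r.
by rewrite mxE !eqxx mul1r.
Qed.

Section Extension.
Variables (C : numClosedFieldType) (g : nat).

(** The unknown is the Gram matrix G of all entries of the [W k] and [V k]. In G the three families
    of equations are linear, and a square root of any semidefinite solution gives back W and V. In
    the dual alternative P, Q and X are the multipliers, evaluated on G of rank one. *)
Lemma kraus_alternative a' a b' b (A : 'I_g -> 'M[C]_(a', a)) (B : 'I_g -> 'M[C]_(b', b)) :
  semidefinite_farkas C ->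
  (exists (I : finType) (W : I -> 'M[C]_(a', b')) (V : I -> 'M[C]_(a, b)),
    [/\ isometries W, isometries V & forall j, B j = \sum_k (W k)^t* *m A j *m V k]) \/
  (exists (P : 'M[C]_b') (Q : 'M[C]_b) (X : 'I_g -> 'M[C]_(b, b')),
    (forall (W : 'M[C]_(a', b')) (V : 'M[C]_(a, b)),
      let s := \tr (P *m (W^t* *m W)) + \tr (Q *m (V^t* *m V)) +
        \sum_j \tr (X j *m (W^t* *m A j *m V)) in 0 <= s + s^*) /\
    let s := \tr P + \tr Q + \sum_j \tr (X j *m B j) in s + s^* < 0).
Proof.
move=> farkas.
pose p i j : 'I_(a' * b' + a * b) := lshift _ (@mxvec_index a' b' i j).
pose r i j : 'I_(a' * b' + a * b) := rshift _ (@mxvec_index a b i j).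
pose I : finType := (('I_b' * 'I_b') + (('I_b * 'I_b) + ('I_g * ('I_b' * 'I_b))))%type.
pose Q (i : I) : 'M[C]_(a' * b' + a * b) :=
  match i with
  | inl m => \sum_i delta_mx (p i m.1) (p i m.2)
  | inr (inl m) => \sum_i delta_mx (r i m.1) (r i m.2)
  | inr (inr (j, m)) => \sum_i \sum_k A j i k *: delta_mx (p i m.1) (r k m.2)
  end.
pose t (i : I) : C :=
  match i with
  | inl m => (m.1 == m.2)%:R
  | inr (inl m) => (m.1 == m.2)%:R
  | inr (inr (j, m)) => B j m.1 m.2
  end.
(* The diagonal constraints of the W-block and the V-block add up to the identity. *)
pose c (i : I) : C :=
  match i with
  | inl m => (m.1 == m.2)%:R
  | inr (inl m) => (m.1 == m.2)%:R
  | inr (inr _) => 0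
  end.
have sumI (V : zmodType) (F : I -> V) : \sum_i F i =
    \sum_m1 \sum_m2 F (inl (m1, m2)) + (\sum_m1 \sum_m2 F (inr (inl (m1, m2))) +
    \sum_j \sum_m1 \sum_m2 F (inr (inr (j, (m1, m2))))).
  rewrite big_sumType /= pair_bigA; congr (_ + _); first by apply: eq_bigr => -[].
  rewrite big_sumType /= pair_bigA; congr (_ + _); first by apply: eq_bigr => -[].
  under [RHS]eq_bigr => j _ do rewrite pair_bigA.
  by rewrite pair_bigA; apply: eq_bigr => -[j []].
have hc : \sum_i c i *: Q i = 1%:M.
  have diag m (F : 'I_m -> 'I_m -> 'M[C]_(a' * b' + a * b)) :
      \sum_m1 \sum_m2 (m1 == m2)%:R *: F m1 m2 = \sum_m1 F m1 m1.
    apply: eq_bigr => m1 _; rewrite (bigD1 m1)//= eqxx scale1r big1 ?addr0// => m2.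
    by rewrite eq_sym => /negbTE ->; rewrite scale0r.
  rewrite sumI /= !diag [X in _ + (_ + X)]big1 ?addr0; last first.
    by move=> j _; do 2!(rewrite big1// => ? _); rewrite scale0r.
  rewrite scalar_mx_sum_delta big_split_ord /=; congr (_ + _).
    rewrite exchange_big pair_bigA /= [RHS](reindex _ (curry_mxvec_bij a' b')) /=.
    by apply: eq_bigr => -[i j] _; rewrite scale1r.
  rewrite exchange_big pair_bigA /= [RHS](reindex _ (curry_mxvec_bij a b)) /=.
  by apply: eq_bigr => -[i j] _; rewrite scale1r.
have trQ (G : 'M[C]_(a' * b' + a * b)) i : \tr (Q i *m G) =
    match i with
    | inl m => \sum_i G (p i m.2) (p i m.1)
    | inr (inl m) => \sum_i G (r i m.2) (r i m.1)
    | inr (inr (j, m)) => \sum_i \sum_k A j i k * G (r k m.2) (p i m.1)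
    end.
  case: i => [m|[m|[j m]]] /=; rewrite mulmx_suml raddf_sum; apply: eq_bigr => i _ /=.
  - exact: mxtrace_delta_mul.
  - exact: mxtrace_delta_mul.
  rewrite mulmx_suml raddf_sum; apply: eq_bigr => k _ /=.
  by rewrite -scalemxAl mxtraceZ mxtrace_delta_mul.
have [[G hG htG]|[y hy hyt]] := farkas _ _ _ t _ hc.
  left; have [Z hZ] := psdmx_sqrt hG.
  pose W k : 'M[C]_(a', b') := \matrix_(i, j) Z (p i j) k.
  pose V k : 'M[C]_(a, b) := \matrix_(i, j) Z (r i j) k.
  exists 'I_(a' * b' + a * b), W, V; split.
  - apply/matrixP => m1 m2; rewrite [RHS]mxE -[RHS](htG (inl (m1, m2))) trQ summxE.
    under eq_bigr => k _ do rewrite mxE.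
    rewrite exchange_big; apply: eq_bigr => i _ /=; rewrite hZ mxE.
    by apply: eq_bigr => k _; rewrite !mxE mulrC.
  - apply/matrixP => m1 m2; rewrite [RHS]mxE -[RHS](htG (inr (inl (m1, m2)))) trQ summxE.
    under eq_bigr => k _ do rewrite mxE.
    rewrite exchange_big; apply: eq_bigr => i _ /=; rewrite hZ mxE.
    by apply: eq_bigr => k _; rewrite !mxE mulrC.
  - move=> j; apply/matrixP => m1 m2.
    rewrite -[LHS](htG (inr (inr (j, (m1, m2))))) trQ summxE /=.
    under [RHS]eq_bigr => k _ do rewrite mxE.
    rewrite [RHS]exchange_big [LHS]exchange_big; apply: eq_bigr => l _ /=.
    under [RHS]eq_bigr => k _ do rewrite mxE mulr_suml.
    rewrite [RHS]exchange_big; apply: eq_bigr => i _ /=.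
    rewrite hZ mxE mulr_sumr; apply: eq_bigr => k _; rewrite !mxE /=; ring.
right.
pose P : 'M[C]_b' := \matrix_(i, j) y (inl (j, i)).
pose Q' : 'M[C]_b := \matrix_(i, j) y (inr (inl (j, i))).
pose X j : 'M[C]_(b, b') := \matrix_(i, k) y (inr (inr (j, (k, i)))).
have trE m n (M : 'M[C]_(m, n)) (N : 'M[C]_(n, m)) :
    \tr (M *m N) = \sum_j \sum_i M i j * N j i.
  by rewrite exchange_big /mxtrace; apply: eq_bigr => i _; rewrite mxE.
have sE (w : I -> C) (M1 : 'M[C]_b') (M2 : 'M[C]_b) (M3 : 'I_g -> 'M[C]_(b', b)) :
    (forall m1 m2, w (inl (m1, m2)) = M1 m1 m2) ->
    (forall m1 m2, w (inr (inl (m1, m2))) = M2 m1 m2) ->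
    (forall j m1 m2, w (inr (inr (j, (m1, m2)))) = M3 j m1 m2) ->
    \sum_i y i * w i = \tr (P *m M1) + \tr (Q' *m M2) + \sum_j \tr (X j *m M3 j).
  move=> h1 h2 h3; rewrite sumI -addrA !trE; congr (_ + (_ + _)).
  - by do 2!(apply: eq_bigr => ? _); rewrite h1 mxE.
  - by do 2!(apply: eq_bigr => ? _); rewrite h2 mxE.
  - apply: eq_bigr => j _; rewrite trE.
    by do 2!(apply: eq_bigr => ? _); rewrite h3 mxE.
exists P, Q', X; split; last first.
  rewrite /=; move: hyt; rewrite (sE t 1%:M 1%:M B) ?mulmx1//.
    by move=> m1 m2; rewrite mxE.
  by move=> m1 m2; rewrite mxE.
move=> W V; rewrite /=.
pose x : 'rV[C]_(a' * b' + a * b) := row_mx (mxvec W) (mxvec V).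
have xp i j : x 0 (p i j) = W i j by rewrite row_mxEl mxvecE.
have xr i j : x 0 (r i j) = V i j by rewrite row_mxEr mxvecE.
have hG : psdmx (x^T *m x^T^t*) := psdmx_gram _.
have Gpq i j : (x^T *m x^T^t*) i j = x 0 i * (x 0 j)^*.
  by rewrite mxE big_ord1 !mxE.
have := hy _ hG.
rewrite (sE _ (W^t* *m W) (V^t* *m V) (fun j => W^t* *m A j *m V)) //.
- move=> m1 m2; rewrite trQ mxE; apply: eq_bigr => i _.
  by rewrite Gpq !xp !mxE mulrC.
- move=> m1 m2; rewrite trQ mxE; apply: eq_bigr => i _.
  by rewrite Gpq !xr !mxE mulrC.
- move=> j m1 m2; rewrite trQ mxE exchange_big; apply: eq_bigr => k _ /=.
  rewrite mxE mulr_suml; apply: eq_bigr => i _.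
  rewrite Gpq xp xr !mxE /=; ring.
Qed.

End Extension.

Section Extension.
Variables (C : numClosedFieldType) (g : nat).

Lemma ev_block a' a (A : 'I_g -> 'M[C]_(a', a)) n n' (Y : 'I_g -> 'M[C]_(n, n'))
    (v1 : 'M[C]_(a, n)) (v2 : 'M[C]_(a, n')) :
  ev A (fun j => block_mx 0 (Y j) 0 0 : 'M[C]_(n + n')) (row_mx v1 v2) = row_mx 0 (ev A Y v1).
Proof.
rewrite /ev; under eq_bigr => j _ do rewrite mul_mx_row mul_row_block !mulmx0 !addr0.
apply/matrixP => i k; rewrite summxE; case: (split_ordP k) => l ->.
  by rewrite row_mxEl mxE big1 // => j _; rewrite row_mxEl mxE.
by rewrite row_mxEr summxE; apply: eq_bigr => j _; rewrite row_mxEr.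
Qed.

Lemma hsnorm_row_mx m n n' (v1 : 'M[C]_(m, n)) (v2 : 'M[C]_(m, n')) :
  hsnorm (row_mx v1 v2) = hsnorm v1 + hsnorm v2.
Proof.
rewrite -hsnorm_adj /hsnorm /hsdot trmxCK tr_row_mx map_col_mx mul_row_col mxtraceD.
by congr (_ + _); rewrite mxtrace_mulC.
Qed.

Lemma hsnorm_col_mx m m' n (v1 : 'M[C]_(m, n)) (v2 : 'M[C]_(m', n)) :
  hsnorm (col_mx v1 v2) = hsnorm v1 + hsnorm v2.
Proof. by rewrite /hsnorm /hsdot tr_col_mx map_row_mx mul_row_col mxtraceD. Qed.

(** A rectangular point is placed as a corner block of a square one, with the same gain. *)
Lemma gain_le_rect a' a b' b (A : 'I_g -> 'M[C]_(a', a)) (B : 'I_g -> 'M[C]_(b', b)) :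
  (forall n (X : 'I_g -> 'M[C]_n) c, gain_le A X c -> gain_le B X c) ->
  forall n n' (Y : 'I_g -> 'M[C]_(n, n')) c, 0 <= c -> gain_le A Y c -> gain_le B Y c.
Proof.
move=> h n n' Y c c0 hA v.
have /h hB : gain_le A (fun j => block_mx 0 (Y j) 0 0 : 'M[C]_(n + n')) c.
  move=> w; rewrite -[w]hsubmxK ev_block !hsnorm_row_mx hsnorm0 add0r.
  by apply: (le_trans (hA _)); rewrite ler_wpM2l// lerDl hsnorm_ge0.
have := hB (row_mx v 0).
by rewrite ev_block !hsnorm_row_mx !hsnorm0 add0r addr0.
Qed.

(** Excludes the dual alternative. Testing W or V alone shows that P and Q have semidefinite
    hermitian parts; perturbed by e these become p p^* and q q^* with p and q invertible, and X = q
    Y p^* defines a point Y. Positivity of the form for A says that A has gain 1 at Y, so B has too,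
    and this contradicts the negative value of the form for B. *)
Lemma compression_of_dominated a' a b' b (A : 'I_g -> 'M[C]_(a', a))
    (B : 'I_g -> 'M[C]_(b', b)) :
  semidefinite_farkas C -> (0 < a' * a)%N ->
  (forall n (X : 'I_g -> 'M[C]_n) c, gain_le A X c -> gain_le B X c) ->
  exists (I : finType) (W : I -> 'M[C]_(a', b')) (V : I -> 'M[C]_(a, b)),
    [/\ isometries W, isometries V & forall j, B j = \sum_k (W k)^t* *m A j *m V k].
Proof.
move=> farkas; rewrite muln_gt0 => /andP[a'0 a0] hdom.
have [//|[P [Q [X [hpos hneg]]]]] := kraus_alternative A B farkas; exfalso.
pose herm n (M : 'M[C]_n) := M + M^t*.
have herm_gram n m (M : 'M[C]_n) (Z : 'M[C]_(m, n)) :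
    \tr (herm n M *m (Z^t* *m Z)) = \tr (M *m (Z^t* *m Z)) + (\tr (M *m (Z^t* *m Z)))^*.
  rewrite mulmxDl mxtraceD; congr (_ + _).
  by rewrite -mxtrace_adj !adjmxM trmxCK mxtrace_mulC.
have row_gram n m (M : 'M[C]_n) (i : 'I_m) (x : 'rV[C]_n) (Z := delta_mx i 0 *m x) :
    \tr (herm n M *m (Z^t* *m Z)) = (x *m herm n M *m x^t*) 0 0.
  have -> : Z^t* *m Z = x^t* *m x.
    rewrite /Z adjmxM -mulmxA [_ *m (_ *m x)]mulmxA trmx_delta map_delta_mx mul_delta_mx.
    suff -> : delta_mx 0 0 = 1%:M :> 'M[C]_1 by rewrite mul1mx.
    by apply/matrixP => k l; rewrite !ord1 !mxE !eqxx.
  by rewrite mulmxA mxtrace_mulC mulmxA /mxtrace big_ord1.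
have hP : psdmx (herm _ P).
  move=> x; rewrite -(row_gram _ _ _ (Ordinal a'0)) herm_gram.
  have := hpos (delta_mx (Ordinal a'0) 0 *m x) 0.
  rewrite [0^t*]adjmx0 !mulmx0 mxtrace0 addr0 big1 ?addr0// => j _.
  by rewrite mulmx0 mulmx0 mxtrace0.
have hQ : psdmx (herm _ Q).
  move=> x; rewrite -(row_gram _ _ _ (Ordinal a0)) herm_gram.
  have := hpos 0 (delta_mx (Ordinal a0) 0 *m x).
  rewrite [0^t*]adjmx0 !mul0mx !mulmx0 mxtrace0 add0r big1 ?addr0// => j _.
  by rewrite !mul0mx mulmx0 mxtrace0.
pose s0 := \tr P + \tr Q + \sum_j \tr (X j *m B j).
(* Small enough that adding e (b' + b), the cost of the perturbation at W = V = 1, keeps the dual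
   value negative. *)
pose e := - (s0 + s0^*) / (b' + b).+1%:R.
have s0neg : 0 < - (s0 + s0^*) by rewrite oppr_gt0.
have e0 : 0 < e by rewrite divr_gt0 ?ltr0n.
have pert n (M : 'M[C]_n) : psdmx (herm n M) -> exists2 r : 'M[C]_n, r \in unitmx &
    herm n M + e%:M = r *m r^t*.
  move=> hM; have he : psdmx (herm n M + e%:M).
    apply: psdmxD => // x; rewrite mul_mx_scalar -scalemxAl mxE mulr_ge0 ?(ltW e0)//.
    by have := psdmx_gram x 1%:M; rewrite mul1mx adjmx1 mulmx1.
  have [r hr] := psdmx_sqrt he; exists r => //.
  rewrite -row_free_unit -kermx_eq0; apply/eqP/row_matrixP => i; rewrite row0.
  set x := row i _; have hx : x *m r = 0 by apply/sub_kermxP/row_sub.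
  have hx0 : (x *m (herm n M + e%:M) *m x^t*) 0 0 = 0 by rewrite hr mulmxA hx !mul0mx mxE.
  apply/eqP; rewrite -hsnorm_eq0 -(mulrI_eq0 _ (lregP (lt0r_neq0 e0))) eq_le.
  rewrite mulr_ge0 ?(ltW e0) ?hsnorm_ge0// andbT -hx0.
  rewrite mulmxDr mulmxDl mxE -[leLHS]add0r lerD//.
  by rewrite mul_mx_scalar -scalemxAl mxE -hsnorm_adj /hsnorm /hsdot trmxCK /mxtrace big_ord1.
have [p pu hp] := pert _ _ hP; have [q qu hq] := pert _ _ hQ.
have gram_tr n m (M r : 'M[C]_n) (Z : 'M[C]_(m, n)) : herm n M + e%:M = r *m r^t* ->
    hsnorm (Z *m r) = \tr (M *m (Z^t* *m Z)) + (\tr (M *m (Z^t* *m Z)))^* + e * hsnorm Z.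
  move=> hr; have -> : hsnorm (Z *m r) = \tr (r *m r^t* *m (Z^t* *m Z)).
    by rewrite /hsnorm /hsdot adjmxM [RHS]mxtrace_mulC !mulmxA mxtrace_mulC !mulmxA.
  by rewrite -hr mulmxDl mxtraceD herm_gram mul_scalar_mx mxtraceZ.
have [Y XY] : exists Y : 'I_g -> 'M[C]_(b, b'), forall j, X j = q *m Y j *m p^t*.
  exists (fun j => invmx q *m X j *m (invmx p)^t*) => j.
  by rewrite !mulmxA mulmxV// mul1mx -mulmxA -adjmxM mulmxV// adjmx1 mulmx1.
have pairE m' m (D : 'I_g -> 'M[C]_(m', m)) (W : 'M[C]_(m', b')) (V : 'M[C]_(m, b)) :
    \sum_j \tr (X j *m (W^t* *m D j *m V)) = hsdot (W *m p) (ev D Y (V *m q)).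
  rewrite /ev hsdot_sumr; apply: eq_bigr => j _; rewrite /hsdot XY adjmxM.
  by rewrite -!mulmxA [q *m (Y j *m _)]mulmxA mxtrace_mulC -!mulmxA.
have total m' m (D : 'I_g -> 'M[C]_(m', m)) (W : 'M[C]_(m', b')) (V : 'M[C]_(m, b))
    (s := \tr (P *m (W^t* *m W)) + \tr (Q *m (V^t* *m V)) +
        \sum_j \tr (X j *m (W^t* *m D j *m V))) :
    s + s^* + e * (hsnorm W + hsnorm V) = hsnorm (W *m p) + hsnorm (V *m q) +
      (hsdot (W *m p) (ev D Y (V *m q)) + hsdot (ev D Y (V *m q)) (W *m p)).
  rewrite (gram_tr _ _ _ _ _ hp) (gram_tr _ _ _ _ _ hq) -[hsdot (ev _ _ _) _]hsdot_conj -pairE /s.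
  by rewrite !rmorphD /=; ring.
have gainA : gain_le A Y 1.
  move=> v; rewrite mul1r; set u := ev A Y v.
  (* This choice gives W p = - u and V q = v, where the form reduces to |v|^2 - |u|^2. *)
  have hs := hpos (- u *m invmx p) (v *m invmx q).
  have ht := total _ _ A (- u *m invmx p) (v *m invmx q).
  rewrite /= in hs ht; rewrite !mulmxKV// hsnormN hsdotNl hsdotNr -/u in ht.
  rewrite -subr_ge0; suff -> : hsnorm v - hsnorm u =
      hsnorm u + hsnorm v + (- hsdot u u - hsdot u u).
    rewrite -ht; apply: addr_ge0; first exact: hs.
    by apply: mulr_ge0; [apply: ltW|apply: addr_ge0; apply: hsnorm_ge0].
  by rewrite /hsnorm; ring.
have gainB : gain_le B Y 1 by apply: (gain_le_rect hdom) => //; apply: ler01.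
have h1 := total _ _ B 1%:M 1%:M.
rewrite !adjmx1 !mul1mx !mulmx1 in h1.
have h2 : 0 <= hsnorm (p + ev B Y q) by apply: hsnorm_ge0.
have h3 := gainB q; rewrite mul1r in h3.
have hn n : hsnorm (1%:M : 'M[C]_n) = n%:R.
  by rewrite /hsnorm /hsdot adjmx1 mulmx1 mxtrace1.
rewrite !hn in h1.
have : 0 <= s0 + s0^* + e * (b'%:R + b%:R).
  have -> : s0 + s0^* + e * (b'%:R + b%:R) =
      hsnorm p + hsnorm q + (hsdot p (ev B Y q) + hsdot (ev B Y q) p).
    rewrite -h1 /s0; congr (_ + _^* + _); congr (_ + _); apply: eq_bigr => j _;
      by rewrite mulmx1 mul1mx.
  (* The right-hand side exceeds |p + B(Y) q|^2 by |q|^2 - |B(Y) q|^2. *)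
  apply: (le_trans h2); rewrite hsnormD; apply: lerD => //.
  by apply: lerD.
move=> hge; have hlt : s0 + s0^* + e * (b'%:R + b%:R) < 0.
  rewrite -[s0 + _]opprK addrC subr_lt0 -natrD /e mulrAC.
  by rewrite ltr_pdivrMr ?ltr0n// ltr_pM2l// ltr_nat.
by have := lt_le_trans hlt hge; rewrite ltxx.
Qed.

End Extension.

(** * Operator norms of pencils *)

Section TensorVectors.
Variable K : comNzRingType.

Definition tensvec a n (v : 'M[K]_(a, n)) : 'cV[K]_(a * n) :=
  \col_k v (mxtens_unindex k).1 (mxtens_unindex k).2.

Lemma tensvec_surj a n (u : 'cV[K]_(a * n)) : exists v, tensvec v = u.
Proof.
exists (\matrix_(i, j) u (mxtens_index (i, j)) 0).
apply/matrixP => k l; rewrite !mxE ord1 -[in RHS](mxtens_unindexK k).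
by rewrite -surjective_pairing.
Qed.

Lemma sum_tens a n (F : 'I_(a * n) -> K) :
  \sum_k F k = \sum_i \sum_j F (mxtens_index (i, j)).
Proof.
rewrite pair_bigA /= (reindex (@mxtens_index a n)) /=.
  by apply: eq_bigr => -[].
by exists (@mxtens_unindex a n) => i _; rewrite ?mxtens_indexK ?mxtens_unindexK.
Qed.

Lemma tensmx_tensvec a' a n (A : 'M[K]_(a', a)) (X : 'M[K]_n) (v : 'M[K]_(a, n)) :
  tensmx A X *m tensvec v = tensvec (A *m v *m X^T).
Proof.
apply/matrixP => k l; rewrite !mxE sum_tens exchange_big; apply: eq_bigr => j _ /=.
rewrite !mxE mulr_suml; apply: eq_bigr => i _.
by rewrite !mxE mxtens_indexK /=; ring.
Qed.

Lemma tensvec_sum a n (I : finType) (F : I -> 'M[K]_(a, n)) :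
  \sum_i tensvec (F i) = tensvec (\sum_i F i).
Proof.
by apply/matrixP => k l; rewrite !(mxE, summxE); apply: eq_bigr => i _; rewrite mxE.
Qed.

End TensorVectors.

Lemma hsnorm_tensvec (C : numClosedFieldType) a n (v : 'M[C]_(a, n)) :
  hsnorm (tensvec v) = hsnorm v.
Proof.
rewrite !hsnormE sum_tens; do 2!(apply: eq_bigr => ? _).
by rewrite big_ord1 mxE mxtens_indexK.
Qed.

Section OperatorNorm.
Variable R : realType.
Local Notation C := (Cplx R).

Lemma ofreal_sum (I : finType) (F : I -> R) :
  ofreal (\sum_i F i) = \sum_i ofreal (F i).
Proof.
apply: (big_morph (@ofreal R)) => // x y.
by apply/eqP; rewrite eq_complex /= addr0 !eqxx.
Qed.

Lemma ofrealM (x y : R) : ofreal (x * y) = ofreal x * ofreal y.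
Proof. by apply/eqP; rewrite eq_complex /= !mul0r !mulr0 subr0 addr0 !eqxx. Qed.

Lemma ofreal_le (x y : R) : (ofreal x <= ofreal y) = (x <= y).
Proof. by rewrite lecE /= eqxx. Qed.

Lemma ofreal_ge0 (x : R) : (0 <= ofreal x) = (0 <= x).
Proof. by rewrite lecE /= eqxx. Qed.

Lemma ge0_ofreal (z : C) : 0 <= z -> exists2 x : R, 0 <= x & z = ofreal x.
Proof. by rewrite cplx_ge0; case: z => a b /= /andP[/eqP -> h]; exists a. Qed.

Lemma l2norm_ge0 n (v : 'cV[C]_n) : 0 <= l2norm v.
Proof. exact: sqrtr_ge0. Qed.

Lemma hsnorm_l2norm n (v : 'cV[C]_n) : hsnorm v = ofreal (l2norm v ^+ 2).
Proof.
rewrite /l2norm sqr_sqrtr ?sumr_ge0// => [|i _]; last by rewrite sqr_ge0.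
rewrite ofreal_sum hsnormE; apply: eq_bigr => i _; rewrite big_ord1.
by rewrite !expr2 ofrealM.
Qed.

Lemma hsnorm_le_l2norm m n (u : 'cV[C]_m) (v : 'cV[C]_n) (r : R) : 0 <= r ->
  (hsnorm u <= ofreal (r ^+ 2) * hsnorm v) = (l2norm u <= r * l2norm v).
Proof.
move=> r0; rewrite !hsnorm_l2norm -ofrealM ofreal_le -exprMn.
by rewrite ler_pXn2r// nnegrE ?mulr_ge0// l2norm_ge0.
Qed.

Lemma gain_bound m n (M : 'M[C]_(m, n)) :
  exists2 r : R, 0 <= r &
    forall p (v : 'M[C]_(n, p)), hsnorm (M *m v) <= ofreal (r ^+ 2) * hsnorm v.
Proof.
have [n0|n0] := posnP n.
  subst n; exists 0 => // p v; rewrite [v]flatmx0 mulmx0 !hsnorm0 mulr0 //.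
have [c [x [/ge0_ofreal[s s0 ->] _ _ hc]]] := max_gain (M^t*) n0.
exists (Num.sqrt s); rewrite ?sqrtr_ge0// => p v; rewrite sqr_sqrtr//.
rewrite -[hsnorm (M *m v)]hsnorm_adj -[hsnorm v]hsnorm_adj adjmxM.
have rowE q k (u : 'M[C]_(q, k)) : hsnorm u = \sum_i hsnorm (row i u).
  rewrite hsnormE; apply: eq_bigr => i _; rewrite hsnormE big_ord1.
  by apply: eq_bigr => j _; rewrite mxE.
rewrite rowE [X in _ * X]rowE mulr_sumr; apply: ler_sum => i _.
by rewrite row_mul.
Qed.

Lemma opnorm_le m n (M : 'M[C]_(m, n)) (r : R) : 0 <= r ->
  opnorm M <= r <-> forall v : 'cV[C]_n, hsnorm (M *m v) <= ofreal (r ^+ 2) * hsnorm v.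
Proof.
move=> r0; have [s s0 hs] := gain_bound M.
pose S := [set l2norm (M *m v) | v in [set v : 'cV[C]_n | l2norm v <= 1]].
have l0 k : l2norm (0 : 'cV[C]_k) = 0.
  by apply/eqP; rewrite -sqrf_eq0; have := hsnorm_l2norm (0 : 'cV[C]_k); rewrite hsnorm0 => -[<-].
have S0 : S !=set0 by exists 0, 0; rewrite /= ?mulmx0 l0.
have ubS : has_ubound S.
  exists s => _ [v /= v1 <-]; have := hs _ v; rewrite hsnorm_le_l2norm// => /le_trans; apply.
  by rewrite -[leRHS]mulr1 ler_wpM2l.
split=> [h v|h].
  rewrite hsnorm_le_l2norm//.
  have [v0|v0] := eqVneq (l2norm v) 0.
    have : hsnorm v == 0 by rewrite hsnorm_l2norm v0 expr0n.
    by rewrite hsnorm_eq0 => /eqP ->; rewrite mulmx0 !l0 mulr0.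
  have vp : 0 < l2norm v by rewrite lt_def v0 l2norm_ge0.
  have scal k (u : 'cV[C]_k) : l2norm (ofreal (l2norm v)^-1 *: u) = (l2norm v)^-1 * l2norm u.
    apply/eqP; rewrite -(@eqrXn2 _ 2)// ?mulr_ge0 ?invr_ge0 ?l2norm_ge0//; apply/eqP.
    have := hsnormZ (ofreal (l2norm v)^-1) u; rewrite !hsnorm_l2norm exprMn.
    rewrite ger0_norm ?ofreal_ge0 ?invr_ge0 ?l2norm_ge0// !expr2 -!ofrealM.
    by move=> [].
  have : S (l2norm (M *m (ofreal (l2norm v)^-1 *: v))).
    by exists (ofreal (l2norm v)^-1 *: v) => //=; rewrite scal mulVf.
  move=> /(ub_le_sup ubS) /le_trans /(_ h).
  by rewrite -scalemxAr scal ler_pdivrMl// mulrC.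
apply: ge_sup => // _ [v /= v1 <-]; have := h v; rewrite hsnorm_le_l2norm// => /le_trans; apply.
by rewrite -[leRHS]mulr1 ler_wpM2l.
Qed.

Lemma opnorm_ge0 m n (M : 'M[C]_(m, n)) : 0 <= opnorm M.
Proof.
rewrite leNgt; apply/negP => h; have [s s0 hs] := gain_bound M.
have : l2norm (M *m (0 : 'cV[C]_n)) <= opnorm M; last first.
  by move=> /(le_trans (l2norm_ge0 _)); rewrite leNgt h.
apply: ub_le_sup.
  exists s => _ [v /= v1 <-]; have := hs _ v; rewrite hsnorm_le_l2norm// => /le_trans; apply.
  by rewrite -[leRHS]mulr1 ler_wpM2l.
exists 0 => //=; have -> : l2norm (0 : 'cV[C]_n) = 0; last exact: ler01.
by apply/eqP; rewrite -sqrf_eq0; have := hsnorm_l2norm (0 : 'cV[C]_n); rewrite hsnorm0 => -[<-].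
Qed.

Lemma opnorm0 m n : opnorm (0 : 'M[C]_(m, n)) = 0.
Proof.
apply/eqP; rewrite eq_le opnorm_ge0 andbT; apply/opnorm_le => // v.
by rewrite mul0mx hsnorm0 mulr_ge0 ?hsnorm_ge0// ofreal_ge0 exprn_ge0.
Qed.

Lemma eq_opnorm m n m' n' (M : 'M[C]_(m, n)) (M' : 'M[C]_(m', n')) :
  (forall r, 0 <= r -> opnorm M <= r <-> opnorm M' <= r) -> opnorm M = opnorm M'.
Proof.
move=> h; apply/eqP; rewrite eq_le.
by rewrite (h _ (opnorm_ge0 M')).2// (h _ (opnorm_ge0 M)).1.
Qed.

End OperatorNorm.

Section PencilNorm.
Variables (R : realType) (g : nat).
Local Notation C := (Cplx R).

Lemma pencil_eval_tensvec a' a (A : pencil R g a' a) n (X : mxpoint R g n) (v : 'M[C]_(a, n)) :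
  pencil_eval A X *m tensvec v = tensvec (ev A (fun j => (X j)^T) v).
Proof.
rewrite /pencil_eval mulmx_suml /ev -tensvec_sum; apply: eq_bigr => j _.
exact: tensmx_tensvec.
Qed.

Lemma opnorm_gain a' a (A : pencil R g a' a) n (X : mxpoint R g n) (r : R) : 0 <= r ->
  opnorm (pencil_eval A X) <= r <-> gain_le A (fun j => (X j)^T) (ofreal (r ^+ 2)).
Proof.
move=> r0; rewrite opnorm_le//; split=> h v.
  by have := h (tensvec v); rewrite pencil_eval_tensvec !hsnorm_tensvec.
have [w <-] := tensvec_surj v.
by rewrite pencil_eval_tensvec !hsnorm_tensvec.
Qed.

Lemma opnorm_pencilZ a' a (A : pencil R g a' a) n (X : mxpoint R g n) (t : R) : 0 < t ->
  opnorm (pencil_eval A (ofreal t *: X)) = t * opnorm (pencil_eval A X).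
Proof.
move=> t0.
have evZ (v : 'M[C]_(a, n)) : hsnorm (ev A (fun j => ((ofreal t *: X) j)^T) v) =
    ofreal (t ^+ 2) * hsnorm (ev A (fun j => (X j)^T) v).
  have -> : ev A (fun j => ((ofreal t *: X) j)^T) v = ofreal t *: ev A (fun j => (X j)^T) v.
    rewrite /ev scaler_sumr; apply: eq_bigr => j _.
    by rewrite ffunE linearZ /= -scalemxAr.
  by rewrite hsnormZ ger0_norm ?ofreal_ge0 ?(ltW t0)// expr2 -ofrealM -expr2.
have t20 : 0 < ofreal (t ^+ 2) by rewrite cplx_gt0 /= eqxx exprn_gt0.
have key r : 0 <= r -> opnorm (pencil_eval A X) <= r <->
    opnorm (pencil_eval A (ofreal t *: X)) <= t * r.
  move=> r0; rewrite !opnorm_gain ?mulr_ge0 ?(ltW t0)//.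
  split=> h v; first by rewrite evZ exprMn (ofrealM (t ^+ 2) (r ^+ 2)) -mulrA ler_pM2l.
  by have := h v; rewrite evZ exprMn (ofrealM (t ^+ 2) (r ^+ 2)) -mulrA ler_pM2l.
apply/eqP; rewrite eq_le; apply/andP; split.
  exact: (key _ (opnorm_ge0 _)).1 (lexx _).
rewrite -ler_pdivlMl//; apply: (key _ _).2.
  by apply: mulr_ge0; [rewrite invr_ge0 ltW|apply: opnorm_ge0].
by rewrite mulrA mulfV ?gt_eqF// mul1r.
Qed.

Lemma ball_dominated a' a b' b (A : pencil R g a' a) (B : pencil R g b' b) :
  (forall n (X : mxpoint R g n), pencil_ball A X -> opnorm (pencil_eval B X) <= 1) ->
  forall n (X : mxpoint R g n), opnorm (pencil_eval B X) <= opnorm (pencil_eval A X).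
Proof.
move=> h n X; rewrite leNgt; apply/negP => hlt.
set p := opnorm _ in hlt; set q := opnorm _ in hlt.
have p0 : 0 <= p := opnorm_ge0 _.
have s0 : 0 < (p + q) / 2 by lra.
(* The scale lies strictly between the two norms, so the rescaled point is in the ball of A while B
   has norm above 1 there. *)
have hX : pencil_ball A (ofreal ((p + q) / 2)^-1 *: X).
  by rewrite /pencil_ball /= opnorm_pencilZ ?invr_gt0// -/p ltr_pdivrMl// mulr1; lra.
have := h _ _ hX; rewrite opnorm_pencilZ ?invr_gt0// -/q ler_pdivrMl// mulr1; lra.
Qed.

Lemma same_ball_opnorm a' a b' b (A : pencil R g a' a) (B : pencil R g b' b) :
  same_ball A B ->
  forall n (X : mxpoint R g n), opnorm (pencil_eval A X) = opnorm (pencil_eval B X).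
Proof.
move=> h n X; apply/eqP; rewrite eq_le; apply/andP.
split; apply: ball_dominated => k Y; first by rewrite -h => /ltW.
by rewrite h => /ltW.
Qed.

Lemma opnorm_dominated_gain a' a b' b (A : pencil R g a' a) (B : pencil R g b' b) :
  (0 < a)%N ->
  (forall n (X : mxpoint R g n), opnorm (pencil_eval B X) <= opnorm (pencil_eval A X)) ->
  forall n (X : 'I_g -> 'M[C]_n) c, gain_le A X c -> gain_le B X c.
Proof.
move=> a0 h n X c hA.
have [n0|n0] := posnP n; first by subst n; apply: gain_le0.
(* A gain ranges over all of [C]; a nonzero test vector makes it real and nonnegative, hence the
   square of a norm bound. *)
have c0 : 0 <= c.
  have v0 : (const_mx 1 : 'M[C]_(a, n)) != 0.
    apply/eqP => /matrixP/(_ (Ordinal a0) (Ordinal n0)); rewrite !mxE => /eqP.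
    by rewrite oner_eq0.
  move: v0; rewrite -hsnorm_gt0 => v0; rewrite -(pmulr_lge0 _ v0).
  exact: le_trans (hsnorm_ge0 _) (hA _).
have [r r0 hr] := ge0_ofreal c0.
have hc : c = ofreal (Num.sqrt r ^+ 2) by rewrite sqr_sqrtr.
pose Y : mxpoint R g n := [ffun j => (X j)^T].
have YX : (fun j => (Y j)^T) = X by apply/funext => j; rewrite ffunE trmxK.
have := h _ Y; rewrite hc -YX -opnorm_gain ?sqrtr_ge0// => hBA.
by rewrite (le_trans hBA)// opnorm_gain ?sqrtr_ge0// YX -hc.
Qed.

Lemma minimal_norm_minimal a' a (A : pencil R g a' a) :
  minimal_defining_pencil A -> norm_minimal A.
Proof.
move=> [hnd hmin] d' d B hB.
have heq n (X : mxpoint R g n) : opnorm (pencil_eval B X) = opnorm (pencil_eval A X).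
  by apply: eq_opnorm => r r0; rewrite !opnorm_gain//; split => /hB.
apply: (hmin _ _ B).
  move=> n X hX; apply: hnd; have := heq n X; rewrite hX opnorm0 => h0.
  have := lexx (0 : R); rewrite {1}h0 opnorm_le// expr0n => h1.
  apply/matrixP => i j; rewrite [RHS]mxE.
  have := h1 (delta_mx j 0); rewrite mul0r => h2.
  have : hsnorm (pencil_eval A X *m delta_mx j (0 : 'I_1)) == 0 by rewrite eq_le h2 hsnorm_ge0.
  by rewrite hsnorm_eq0 -colE => /eqP/matrixP/(_ i 0); rewrite !mxE.
by move=> n; apply/seteqP; split => X; rewrite /pencil_ball /= heq.
Qed.

End PencilNorm.

(** * Nilpotent points *)

Section Blocks.
Variables (C : numClosedFieldType) (m n : nat).

(* The projection of C^(m+1) (x) C^n onto its k-th block; it vanishes for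
   k > m, so that no bound on block indices is needed below. *)
Definition blk (k : nat) : 'M[C]_(n, m.+1 * n) :=
  \matrix_(i, q) (((mxtens_unindex q).1 == k :> nat) && ((mxtens_unindex q).2 == i))%:R.

Lemma blkE k i (p : 'I_m.+1) j :
  blk k i (mxtens_index (p, j)) = ((p == k :> nat) && (j == i))%:R.
Proof. by rewrite mxE mxtens_indexK. Qed.

Lemma blk_big k : (m < k)%N -> blk k = 0.
Proof.
move=> hk; apply/matrixP => i q; rewrite !mxE.
by rewrite ltn_eqF// (leq_trans (ltn_ord _)).
Qed.

Lemma blk_adj k : (blk k)^t* = (blk k)^T.
Proof. by apply/matrixP => i j; rewrite !mxE /= conjC_nat. Qed.

Lemma blk_orth k l : (k <= m)%N -> blk k *m (blk l)^T = (k == l)%:R%:M.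
Proof.
move=> hk; apply/matrixP => i j; rewrite !mxE sum_tens.
rewrite (bigD1 (Ordinal (hk : k < m.+1)%N))//= [X in _ + X]big1 ?addr0; last first.
  move=> p hp; rewrite big1 // => q _; rewrite blkE.
  have /negbTE -> : p != k :> nat by apply: contra_neq hp => e; apply: val_inj.
  by rewrite mul0r.
rewrite (bigD1 i)//= [X in _ + X]big1 ?addr0; last first.
  by move=> q /negbTE hq; rewrite blkE hq andbF mul0r.
rewrite [(blk l)^T _ _]mxE !blkE /= !eqxx mul1r.
by case: (k == l); rewrite /= ?mulr1n ?mul0rn.
Qed.

Lemma blk_sum : \sum_(k < m.+1) (blk k)^T *m blk k = 1%:M.
Proof.
apply/matrixP => p q; rewrite summxE.
rewrite -[p]mxtens_unindexK -[q]mxtens_unindexK.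
case: (mxtens_unindex p) => p1 p2; case: (mxtens_unindex q) => q1 q2.
rewrite (bigD1 p1)//= [X in _ + X]big1 ?addr0; last first.
  move=> k hk; rewrite mxE big1// => i _; rewrite mxE blkE.
  have /negbTE -> : p1 != k :> nat by rewrite eq_sym.
  by rewrite mul0r.
rewrite mxE (bigD1 p2)//= [X in _ + X]big1 ?addr0; last first.
  by move=> i /negbTE hi; rewrite mxE blkE eq_sym hi andbF mul0r.
rewrite [(blk p1)^T _ _]mxE !blkE !eqxx mul1r mxE.
rewrite (inj_eq (can_inj (@mxtens_indexK _ _))) xpair_eqE.
by congr ((nat_of_bool _)%:R); congr andb; exact: eq_sym.
Qed.

Lemma blk_norm a (v : 'M[C]_(a, m.+1 * n)) :
  hsnorm v = \sum_(k < m.+1) hsnorm (v *m (blk k)^T).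
Proof.
have hI : isometries (fun k : 'I_m.+1 => blk k).
  by rewrite /isometries -[RHS]blk_sum; apply: eq_bigr => k _; rewrite blk_adj.
rewrite -[LHS]hsnorm_adj -(isometries_norm _ hI); apply: eq_bigr => k _.
by rewrite -[LHS]hsnorm_adj adjmxM trmxCK blk_adj.
Qed.

Lemma blk_norm_embed a (v : 'M[C]_(a, n)) k : (k <= m)%N -> hsnorm (v *m blk k) = hsnorm v.
Proof.
move=> hk; rewrite -[LHS]hsnorm_adj adjmxM hsnorm_isometry ?hsnorm_adj//.
by rewrite trmxCK blk_adj blk_orth// eqxx.
Qed.

Variable g : nat.
Variable M : nat -> 'I_g -> 'M[C]_n.

(** Block (k, k+1) is [M k j], all others vanish. A word of length p links block k only to block k +
    p, with weight [wordprod M k]: position separates the lengths of words, and words longer than m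
    vanish. *)
Definition nilpoint : {ffun 'I_g -> 'M[C]_(m.+1 * n)} :=
  [ffun j => \sum_(k < m) (blk k)^T *m M k j *m blk k.+1].

Lemma blk_nilpoint k j : blk k *m nilpoint j = M k j *m blk k.+1.
Proof.
have [hk|hk] := ltnP m k; first by rewrite !blk_big ?mul0mx ?mulmx0// ltnW.
rewrite ffunE mulmx_sumr.
have [hkm|hkm] := ltnP k m.
  rewrite (bigD1 (Ordinal hkm))//= !mulmxA blk_orth// eqxx mul1mx big1 ?addr0//.
  move=> l hl; rewrite !mulmxA blk_orth//.
  have /negbTE -> : k != l by apply: contra_neq hl => e; apply: val_inj.
  by rewrite mul_scalar_mx scale0r mul0mx.
rewrite [blk k.+1]blk_big ?ltnS// mulmx0 big1// => l _; rewrite !mulmxA blk_orth//.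
by rewrite gtn_eqF ?(leq_trans (ltn_ord l))// mul_scalar_mx scale0r mul0mx.
Qed.

Fixpoint wordprod (k : nat) (w : seq 'I_g) : 'M[C]_n :=
  if w is j :: u then M k j *m wordprod k.+1 u else 1%:M.

End Blocks.

Section NilpotentGain.
Variables (C : numClosedFieldType) (m n g : nat) (M : nat -> 'I_g -> 'M[C]_n).
Local Notation Z := (nilpoint m M).
Local Notation "'Zt'" := (fun j => (nilpoint m M j)^T).

Lemma ev_nilpoint a' a (A : 'I_g -> 'M[C]_(a', a)) (v : 'M[C]_(a, m.+1 * n)) k :
  ev A Zt v *m (blk C m n k)^T =
  ev A (fun j => (M k j)^T) (v *m (blk C m n k.+1)^T).
Proof.
rewrite /ev mulmx_suml; apply: eq_bigr => j _.
by rewrite -!mulmxA -!trmx_mul blk_nilpoint.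
Qed.

(** A block shift acts orthogonally between distinct blocks, so its gain is controlled step by
    step. *)
Lemma gain_le_nilpoint a' a (A : 'I_g -> 'M[C]_(a', a)) c : 0 <= c ->
  (forall k, (k < m)%N -> gain_le A (fun j => (M k j)^T) c) -> gain_le A Zt c.
Proof.
move=> c0 h v; rewrite blk_norm [X in _ * X]blk_norm big_ord_recr big_ord_recl /=.
rewrite [X in _ + hsnorm X]ev_nilpoint blk_big ?ltnS// trmx0 mulmx0.
have -> : ev A (fun j => (M m j)^T) (0 : 'M[C]_(a, n)) = 0.
  by rewrite /ev big1 // => j _; rewrite mulmx0 mul0mx.
rewrite hsnorm0 addr0 mulrDr -[leLHS]add0r; apply: lerD.
  by rewrite mulr_ge0 ?hsnorm_ge0.
rewrite mulr_sumr; apply: ler_sum => k _; rewrite ev_nilpoint.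
by apply: h.
Qed.

End NilpotentGain.

Lemma gain_le_shift (C : numClosedFieldType) n g (X : 'I_g -> 'M[C]_n) a' a
    (A : 'I_g -> 'M[C]_(a', a)) c : 0 <= c ->
  gain_le A (fun j => (nilpoint 1 (fun _ => X) j)^T) c <-> gain_le A (fun j => (X j)^T) c.
Proof.
move=> c0; split=> [h w|h]; last by apply: gain_le_nilpoint.
have := h (w *m blk C 1 n 1); rewrite blk_norm_embed//; apply: le_trans.
rewrite [leRHS]blk_norm big_ord_recl /= ev_nilpoint -mulmxA blk_orth// eqxx mulmx1.
by rewrite lerDl sumr_ge0// => k _; apply: hsnorm_ge0.
Qed.

Lemma big_tuple_cons (V : zmodType) (T : finType) p (F : seq T -> V) :
  \sum_(w : p.+1.-tuple T) F w = \sum_i \sum_(u : p.-tuple T) F (i :: u).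
Proof.
rewrite pair_bigA (reindex (fun iu : T * p.-tuple T => [tuple of iu.1 :: iu.2])) //=.
exists (fun w => (thead w, [tuple of behead w])) => [[i u] _|w _] /=.
  by rewrite theadE; congr (_, _); apply: val_inj.
by rewrite [RHS]tuple_eta; apply: val_inj.
Qed.

Lemma big_tuple0 (V : zmodType) (T : finType) (F : seq T -> V) :
  \sum_(w : 0.-tuple T) F w = F [::].
Proof.
rewrite (bigD1 [tuple])//= big1 ?addr0 // => w.
by rewrite [w]tuple0 => /eqP.
Qed.

(** * Power series at nilpotent points *)

Section Evaluation.
Variables (R : realType) (g l' l : nat) (f : fps R g l' l).
Local Notation C := (Cplx R).

Lemma fps_homog_tensvec n (X : mxpoint R g n) p (v : 'M[C]_(l, n)) :
  fps_homog f X p *m tensvec v =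
  tensvec (\sum_(w : p.-tuple 'I_g) f w *m v *m (word_eval X w)^T).
Proof.
rewrite /fps_homog mulmx_suml -tensvec_sum; apply: eq_bigr => w _.
exact: tensmx_tensvec.
Qed.

Lemma blk_word m n (M : nat -> 'I_g -> 'M[C]_n) k w :
  blk C m n k *m word_eval (nilpoint m M) w = wordprod M k w *m blk C m n (k + size w).
Proof.
elim: w k => [|j w ih] k; first by rewrite /word_eval big_nil mulmx1 mul1mx addn0.
rewrite /word_eval big_cons -mulmxE mulmxA blk_nilpoint -mulmxA.
by rewrite [blk _ _ _ _ *m _]ih /= mulmxA addSnnS.
Qed.

Lemma word_eval_nilpoint m n (M : nat -> 'I_g -> 'M[C]_n) w :
  (m < size w)%N -> word_eval (nilpoint m M) w = 0.
Proof.
move=> hw; rewrite -[LHS]mul1mx -blk_sum mulmx_suml big1// => k _.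
rewrite -mulmxA blk_word [blk _ _ _ (_ + _)]blk_big ?mulmx0//.
exact: leq_trans hw (leq_addl _ _).
Qed.

Lemma fps_eval_finite n (X : mxpoint R g n) m :
  (forall p, (m < p)%N -> fps_homog f X p = 0) ->
  fps_eval f X = \sum_(p < m.+1) fps_homog f X p.
Proof.
move=> h; apply: cvg_lim; first exact: norm_hausdorff.
apply: cvg_near_cst; near=> N.
have hN : (m < N)%N by near: N; exists m.+1.
rewrite /series /= (big_cat_nat (n := m.+1))//= [X in _ + X]big1_seq ?addr0; last first.
  by move=> p; rewrite mem_index_iota => /andP[_ /andP[hp _]]; apply: h.
by rewrite big_mkord.
Unshelve. all: by end_near. Qed.

Lemma fps_eval_nilpoint m n (M : nat -> 'I_g -> 'M[C]_n) :
  fps_eval f (nilpoint m M) = \sum_(p < m.+1) fps_homog f (nilpoint m M) p.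
Proof.
apply: fps_eval_finite => p hp; rewrite /fps_homog big1// => w _.
by rewrite word_eval_nilpoint ?size_tuple// mxtens.tensmx0.
Qed.

Lemma fps_eval0_nil : fps_eval f (0 : mxpoint R g 1) = 0 -> f [::] = 0.
Proof.
rewrite (@fps_eval_finite _ _ 0); last first.
  move=> [//|p] _.
  rewrite /fps_homog (big_tuple_cons _ (fun w => tensmx (f w) (word_eval _ w))).
  rewrite big1// => j _; rewrite big1// => u _.
  by rewrite /word_eval big_cons ffunE mul0r mxtens.tensmx0.
rewrite big_ord1 /fps_homog (big_tuple0 (fun w => tensmx (f w) (word_eval _ w))).
move=> /matrixP h; apply/matrixP => i j; have := h (mxtens_index (i, 0)) (mxtens_index (j, 0)).
by rewrite mxtens.tensmxE /word_eval big_nil !mxE eqxx mulr1.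
Qed.

End Evaluation.

Lemma ae_lebesgue_ex (R : realType) (P : R -> Prop) :
  {ae (@lebesgue_measure R), forall t, P t} -> exists t, P t.
Proof.
move=> [N [mN N0 hN]]; apply: contrapT => /forallNP hP.
have hNT : N = setT by apply/seteqP; split => // t _; apply: hN; apply: hP.
have : (lebesgue_measure (`[0%R, 1%R]%classic : set R) <= 0)%E.
  by rewrite -N0; apply: le_measure; rewrite ?inE// hNT.
by rewrite lebesgue_measure_itv /= lte_fin ltr01 oppr0 adde0 lee_fin ler10.
Qed.

Lemma ofreal_cvg (R : realType) (x : R) : ofreal y @[y --> x] --> (ofreal x : Cplx R).
Proof.
apply/cvgrPdist_lt => e; rewrite cplx_gt0 => /andP[/eqP he e0].
near=> y; have -> : ofreal x - ofreal y = ofreal (x - y).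
  by apply/eqP; rewrite eq_complex /= subrr !eqxx.
rewrite [ltLHS]normc_def /= expr0n addr0 sqrtr_sqr ltcE /= he eqxx /=.
near: y; exact: (@cvgr_dist_lt _ _ _ (nbhs x) _ id).
Unshelve. all: by end_near. Qed.

(** * The linear part of a pencil ball map *)

Section FirstOrder.
Variables (R : realType) (g : nat).
Local Notation C := (Cplx R).

Lemma opnorm_shift a' a (A : pencil R g a' a) n (X : mxpoint R g n) :
  opnorm (pencil_eval A (nilpoint 1 (fun _ => X) : mxpoint R g (2 * n))) =
  opnorm (pencil_eval A X).
Proof.
apply: eq_opnorm => r r0; rewrite !opnorm_gain//; apply: gain_le_shift.
by rewrite ofreal_ge0 exprn_ge0.
Qed.

Lemma norm_polar (t : R) : `|polar 1 t| = 1.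
Proof. by rewrite [LHS]normc_def /= !mul1r cos2Dsin2 sqrtr1. Qed.

Lemma opnorm_unimodular m n (c : C) (M : 'M[C]_(m, n)) : `|c| = 1 ->
  opnorm (c *: M) = opnorm M.
Proof.
move=> hc; apply: eq_opnorm => r r0.
have e v : hsnorm (c *: M *m v) = hsnorm (M *m v) :> C.
  by rewrite -scalemxAl hsnormZ hc expr1n mul1r.
by split=> /(opnorm_le _ r0) h; apply/(opnorm_le _ r0) => v; have := h v; rewrite e.
Qed.

Lemma fps_eval_shift l' l (f : fps R g l' l) n (X : mxpoint R g n) c :
  f [::] = 0 ->
  fps_eval f (c *: nilpoint 1 (fun _ => X) : mxpoint R g (2 * n)) =
  c *: pencil_eval (fun j => f [:: j]) (nilpoint 1 (fun _ => X)).
Proof.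
move=> f0; have -> : c *: nilpoint 1 (fun _ => X) = nilpoint 1 (fun _ j => c *: X j).
  apply/ffunP => j; rewrite !ffunE !big_ord1.
  by rewrite -scalemxAr -scalemxAl.
rewrite fps_eval_nilpoint big_ord_recl big_ord1 /fps_homog.
rewrite (big_tuple0 (fun w => tensmx (f w) (word_eval _ w))) f0 mxtens.tens0mx add0r.
rewrite (big_tuple_cons _ (fun w => tensmx (f w) (word_eval _ w))).
rewrite /pencil_eval scaler_sumr; apply: eq_bigr => j _.
rewrite (big_tuple0 (fun u => tensmx (f (j :: u)) (word_eval _ (j :: u)))).
rewrite /word_eval big_cons big_nil mulr1 !ffunE !big_ord1 -scalemxAr -scalemxAl.
by apply/matrixP => p q; rewrite !mxE mulrCA.
Qed.

(* On the nilpotent points [X (x) E_12] the series reduces to its linear part. *)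
Lemma linear_part_sphere d' d (L : pencil R g d' d) l' l (f : fps R g l' l) :
  f [::] = 0 -> pencil_ball_map L f ->
  forall n (X : mxpoint R g n), opnorm (pencil_eval L X) = 1 ->
    opnorm (pencil_eval (fun j => f [:: j]) X) = 1.
Proof.
move=> f0 [_ _ hf] n X hX.
have hZ : pencil_sphere L (nilpoint 1 (fun _ => X) : mxpoint R g (2 * n)).
  by rewrite /pencil_sphere /= opnorm_shift.
(* One angle suffices: f is linear along this ray, and the factor exp(it) does not change the
   norm. *)
have [t [Y hY hY1]] := ae_lebesgue_ex (hf _ _ hZ).
rewrite -opnorm_shift; set Y0 := pencil_eval _ _.
rewrite -(opnorm_unimodular Y0 (norm_polar t)).
suff -> : polar 1 t *: Y0 = Y by [].
apply: (cvg_unique (@norm_hausdorff _ _) _ hY).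
have -> : (fun r => fps_eval f (polar r t *: nilpoint 1 (fun _ => X) : mxpoint R g (2 * n))) =
    (fun r => ofreal r *: (polar 1 t *: Y0)).
  apply/funext => r; rewrite fps_eval_shift// scalerA; congr (_ *: _).
  by apply/eqP; rewrite eq_complex /= !mul1r !mul0r subr0 addr0 !eqxx.
move: (polar 1 t *: Y0) => Y1.
have h1 : ofreal r @[r --> (1 : R)^'-] --> (ofreal 1 : C).
  by apply: cvg_at_left_filter; apply: ofreal_cvg.
have h2 : ofreal r *: Y1 @[r --> (1 : R)^'-] --> ofreal 1 *: Y1 by apply: cvgZr_tmp.
by rewrite [ofreal 1]/(1 : C) scale1r in h2.
Qed.

(** Homogeneity reduces everything to the sphere, except where A(X) = 0; nondegeneracy gives X = 0
    there. *)
Lemma linear_part_norm a' a (A : pencil R g a' a) b' b (B : pencil R g b' b) :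
  nondegenerate_pencil A ->
  (forall n (X : mxpoint R g n), opnorm (pencil_eval A X) = 1 -> opnorm (pencil_eval B X) = 1) ->
  forall n (X : mxpoint R g n), opnorm (pencil_eval B X) = opnorm (pencil_eval A X).
Proof.
move=> hnd h n X; have [p0|p0] := eqVneq (opnorm (pencil_eval A X)) 0.
  have A0 : pencil_eval A X = 0.
    have := lexx (0 : R); rewrite -{1}p0 opnorm_le// expr0n => h1.
    apply/matrixP => i j; rewrite [RHS]mxE.
    have := h1 (delta_mx j 0); rewrite mul0r => h2.
    have : hsnorm (pencil_eval A X *m delta_mx j (0 : 'I_1)) == 0 by rewrite eq_le h2 hsnorm_ge0.
    by rewrite hsnorm_eq0 -colE => /eqP/matrixP/(_ i 0); rewrite !mxE.
  rewrite p0 (hnd _ _ A0) /pencil_eval big1 ?opnorm0// => j _.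
  by rewrite ffunE mxtens.tensmx0.
have pp : 0 < opnorm (pencil_eval A X) by rewrite lt_def p0 opnorm_ge0.
set p := opnorm _ in p0 pp *.
have := h _ (ofreal p^-1 *: X); rewrite !opnorm_pencilZ ?invr_gt0// -/p mulVf// => /(_ erefl).
by move=> hq; apply: (mulfI (invr_neq0 p0)); rewrite hq mulVf.
Qed.

End FirstOrder.

(** * Coefficients of words of length at least two *)

Section WordPoint.
Variables (C : numClosedFieldType) (g n : nat).
Variables (X : 'I_g -> 'M[C]_n) (c : C) (w' : seq 'I_g).

(* Steps from block to block of the nilpotent point that reads off the
   coefficients of the words [i :: w']. *)
Definition wordstep (k : nat) (j : 'I_g) : 'M[C]_n :=
  (* Past the end of [w'] the default j would make the test true; the points below only use k' <
     [size w']. *)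
  if k is k'.+1 then (if j == nth j w' k' then c else 0)%:M else X j.

Lemma wordprod_tail k (u : seq 'I_g) : (size u + k)%N = size w' ->
  wordprod wordstep k.+1 u = (if u == drop k w' then c ^+ size u else 0)%:M.
Proof.
elim: u k => [|j u ih] k /= hk.
  by rewrite drop_oversize ?eqxx ?expr0// -hk.
have hkw : (k < size w')%N by rewrite -hk addSn ltnS leq_addl.
rewrite ih; last by rewrite addnS -addSn.
rewrite [drop k w'](drop_nth j)// eqseq_cons; case: eqP => _ /=; last by rewrite raddf0 mul0mx.
by case: eqP => _; rewrite -scalar_mxM ?exprS ?mulr0.
Qed.

End WordPoint.

Section HigherOrder.
Variables (R : realType) (g : nat).
Local Notation C := (Cplx R).

Lemma pencil_bound a' a (A : pencil R g a' a) :
  exists2 r : R, 0 <= r &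
    forall j p (v : 'M[C]_(a, p)), hsnorm (A j *m v) <= ofreal (r ^+ 2) * hsnorm v.
Proof.
have h j : {r : R | 0 <= r &
    forall p (v : 'M[C]_(a, p)), hsnorm (A j *m v) <= ofreal (r ^+ 2) * hsnorm v}.
  exact/cid2/gain_bound.
pose r j := s2val (h j).
have r0 j : 0 <= r j by rewrite /r; case: (h j).
exists (\sum_j r j); first by apply: sumr_ge0.
move=> j p v; apply: (@le_trans _ _ (ofreal (r j ^+ 2) * hsnorm v)).
  by rewrite /r; case: (h j).
rewrite ler_wpM2r ?hsnorm_ge0// ofreal_le ler_pXn2r ?nnegrE ?sumr_ge0//.
by rewrite (bigD1 j)//= lerDl sumr_ge0.
Qed.

(** The first step of the shift is X itself and the others are c times single coefficients of A, so
    c only has to make the latter small, independently of X. *)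
Lemma wordstep_ball a' a (A : pencil R g a' a) (w' : seq 'I_g) :
  exists2 c : C, c != 0 & forall n (X : mxpoint R g n), pencil_ball A X ->
    pencil_ball A (nilpoint (size w').+1 (wordstep X c w')).
Proof.
have [r r0 hr] := pencil_bound A.
(* This makes s r <= 1/2; the summand 1 keeps the denominator positive when r = 0. *)
pose s : R := (2 * (r + 1))^-1.
have s0 : 0 < s by rewrite invr_gt0; lra.
exists (ofreal s).
  by rewrite eq_complex /= eqxx andbT gt_eqF.
move=> n X hX; rewrite /pencil_ball /=.
pose t := Num.max (opnorm (pencil_eval A X)) (1 / 2).
have t0 : 0 <= t by rewrite /t le_max opnorm_ge0.
have t1 : t < 1 by rewrite /t gt_max hX /=; lra.
apply: le_lt_trans t1; rewrite opnorm_gain//; apply: gain_le_nilpoint.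
  by rewrite ofreal_ge0 exprn_ge0.
case=> [|k] hk; first by rewrite -opnorm_gain// /t le_max lexx.
move=> v.
case: w' hk => [//|j0 w']; rewrite /= ltnS => hk.
set w := j0 :: w'.
have -> : ev A (fun j => (wordstep X (ofreal s) w k.+1 j)^T) v =
    ofreal s *: (A (nth j0 w k) *m v).
  rewrite /ev (bigD1 (nth j0 w k))//= (set_nth_default j0)// eqxx.
  rewrite tr_scalar_mx mul_mx_scalar big1 ?addr0// => j hj.
  by rewrite (set_nth_default j0)// (negbTE hj) tr_scalar_mx mul_mx_scalar scale0r.
rewrite hsnormZ ger0_norm ?ofreal_ge0 ?(ltW s0)//.
apply: (@le_trans _ _ (ofreal s ^+ 2 * (ofreal (r ^+ 2) * hsnorm v))).
  by apply: ler_wpM2l; [rewrite exprn_ge0// ofreal_ge0 ltW|apply: hr].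
rewrite mulrA; apply: ler_wpM2r; first exact: hsnorm_ge0.
rewrite expr2 -!ofrealM ofreal_le -expr2 -exprMn.
rewrite ler_pXn2r ?nnegrE ?mulr_ge0 ?(ltW s0)//.
apply: (@le_trans _ _ (1 / 2)); last by rewrite /t le_max lexx orbT.
by rewrite /s ler_pdivrMl; lra.
Qed.

(** Put v1 in block 1, v2 in the last block, and read block 0 of the image. Only single letters link
    block 0 to block 1, and to the last block only words i :: w', of weight c^|w'| X_i. For nonempty
    w' the two blocks are distinct, so the squared norms of v1 and v2 add. *)
Lemma higher_order_contraction l' l (f : fps R g l' l) n (X : mxpoint R g n) c
    (w' : seq 'I_g) (v1 v2 : 'M[C]_(l, n)) :
  w' != [::] ->
  opnorm (fps_eval f (nilpoint (size w').+1 (wordstep X c w') : mxpoint R g _)) <= 1 ->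
  hsnorm (ev (fun j => f [:: j]) (fun j => (X j)^T) v1 +
          ev (fun j => c ^+ size w' *: f (j :: w')) (fun j => (X j)^T) v2) <=
  hsnorm v1 + hsnorm v2.
Proof.
move=> w'0; set m := (size w').+1; set Z : mxpoint R g _ := nilpoint _ _.
have m1 : (1 < m)%N by rewrite /m ltnS lt0n size_eq0.
rewrite opnorm_le// => hf.
pose v := v1 *m blk C m n 1 + v2 *m blk C m n m.
have hv : hsnorm v = hsnorm v1 + hsnorm v2.
  have cross p q (u1 u2 : 'M[C]_(l, n)) : (p <= m)%N -> p != q ->
      hsdot (u1 *m blk C m n q) (u2 *m blk C m n p) = 0.
    move=> hp /negbTE hpq; rewrite /hsdot adjmxM -mulmxA mxtrace_mulC -!mulmxA.
    by rewrite blk_adj blk_orth// hpq mul_mx_scalar scale0r mulmx0 mxtrace0.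
  rewrite hsnormD !blk_norm_embed// ?(ltnW m1)// !cross// ?addr0//; last by rewrite gtn_eqF.
  by rewrite ltn_eqF// ltnW.
rewrite -hv.
pose H p (x : 'M[C]_(l, n)) : 'M[C]_(l', n) :=
  \sum_(w : p.-tuple 'I_g) f w *m x *m (wordprod (wordstep X c w') 0 w)^T.
pose y := \sum_(p < m.+1) \sum_(w : p.-tuple 'I_g) f w *m v *m (word_eval Z w)^T.
have hy : fps_eval f Z *m tensvec v = tensvec y.
  rewrite fps_eval_nilpoint mulmx_suml -tensvec_sum; apply: eq_bigr => p _.
  exact: fps_homog_tensvec.
have yv : hsnorm y <= hsnorm v.
  have := hf (tensvec v); rewrite hy !hsnorm_tensvec expr1n.
  by rewrite [ofreal 1]/(1 : C) mul1r.
apply: le_trans yv.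
have -> : ev (fun j => f [:: j]) (fun j => (X j)^T) v1 +
    ev (fun j => c ^+ size w' *: f (j :: w')) (fun j => (X j)^T) v2 = y *m (blk C m n 0)^T.
  have HE : y *m (blk C m n 0)^T = \sum_(p < m.+1) H p (v *m (blk C m n p)^T).
    rewrite mulmx_suml; apply: eq_bigr => p _; rewrite mulmx_suml; apply: eq_bigr => w _.
    rewrite -!mulmxA -!trmx_mul; congr (_ *m (_ *m _^T)).
    by rewrite blk_word add0n size_tuple.
  have vE (p : 'I_m.+1) : v *m (blk C m n p)^T =
      (if 1%N == p then v1 else 0) + (if m == p then v2 else 0).
    rewrite mulmxDl -!mulmxA !blk_orth// ?(ltnW m1)// !mul_mx_scalar.
    by do 2!case: eqP => _; rewrite ?scale1r ?scale0r.
  have HD p x x' : H p (x + x') = H p x + H p x'.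
    by rewrite /H -big_split; apply: eq_bigr => w _; rewrite mulmxDr mulmxDl.
  have H0 p : H p 0 = 0 by rewrite /H big1 // => w _; rewrite mulmx0 mul0mx.
  rewrite HE; under eq_bigr => p _ do rewrite vE HD.
  rewrite big_split /=; congr (_ + _).
    rewrite (bigD1 (Ordinal (ltnW m1 : 1 < m.+1)%N))//= big1 ?addr0; last first.
      by move=> p hp; rewrite ifF ?H0//; apply: contra_neqF hp => /eqP e; apply: val_inj.
    rewrite /H (big_tuple_cons _ (fun w => f w *m v1 *m (wordprod (wordstep X c w') 0 w)^T)).
    apply: eq_bigr => j _.
    rewrite (big_tuple0 (fun u => f (j :: u) *m v1 *m (wordprod (wordstep X c w') 0 (j :: u))^T)).
    by rewrite /= mulmx1.
  rewrite big_ord_recr /= eqxx big1 ?add0r; last first.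
    by move=> p _; rewrite ifF ?H0// gtn_eqF.
  rewrite /H (big_tuple_cons _ (fun w => f w *m v2 *m (wordprod (wordstep X c w') 0 w)^T)).
  apply: eq_bigr => j _ /=.
  rewrite (bigD1 (in_tuple w'))//= wordprod_tail ?addn0// drop0 eqxx big1 ?addr0; last first.
    move=> u hu; rewrite wordprod_tail ?size_tuple ?addn0// drop0 ifF.
      by rewrite raddf0 mulmx0 trmx0 mulmx0.
    by apply: contra_neqF hu => /eqP e; apply: val_inj.
  by rewrite mul_mx_scalar linearZ /= -scalemxAr -!scalemxAl.
rewrite [leRHS]blk_norm big_ord_recl lerDl sumr_ge0// => k _.
exact: hsnorm_ge0.
Qed.

End HigherOrder.

Theorem corollary1p4 (R : realType) (g d' d l' l : nat)
    (L : pencil R g d' d) (Lt : pencil R g l' l) (f : fps R g l' l)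
    (L_nondeg : nondegenerate_pencil L)
    (Lt_min : minimal_defining_pencil_for L Lt)
    (f_ball_map : pencil_ball_map L f)
    (f0 : forall n, fps_eval f (0 : mxpoint R g n) = 0) :
  exists (U : 'M[Cplx R]_l') (V : 'M[Cplx R]_l),
    [/\ U \is unitarymx, V \is unitarymx &
        f =1 pencil_fps (fun j => U *m Lt j *m V^t*)].
Proof.
have [hmin hball] := Lt_min.
(* If a dimension is zero, all coefficient matrices coincide and identities serve as unitaries. *)
have [ll0|ll0] := posnP (l' * l).
  have triv (M N : 'M[Cplx R]_(l', l)) : M = N.
    apply/matrixP => i j; suff : (0 < l' * l)%N by rewrite ll0.
    by rewrite muln_gt0 (leq_ltn_trans _ (ltn_ord i)) ?(leq_ltn_trans _ (ltn_ord j)).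
  exists 1%:M, 1%:M; split; last by move=> w; apply: triv.
    by apply/unitarymxP; rewrite adjmx1 mulmx1.
  by apply/unitarymxP; rewrite adjmx1 mulmx1.
have l0 : (0 < l)%N by move: ll0; rewrite muln_gt0 => /andP[].
have fnil : f [::] = 0 by apply: fps_eval0_nil.
pose B : pencil R g l' l := fun j => f [:: j].
have hAL := same_ball_opnorm hball.
have hBA n (X : mxpoint R g n) : opnorm (pencil_eval B X) = opnorm (pencil_eval Lt X).
  apply: linear_part_norm => [|k Y hY]; first exact: hmin.1.
  by apply: (linear_part_sphere fnil f_ball_map); rewrite -hAL.
have nmA := minimal_norm_minimal hmin.
have domAB : forall n (X : 'I_g -> 'M[Cplx R]_n) c, gain_le Lt X c -> gain_le B X c.
  by apply: (opnorm_dominated_gain l0) => n X; rewrite hBA lexx.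
have domBA : forall n (X : 'I_g -> 'M[Cplx R]_n) c, gain_le B X c -> gain_le Lt X c.
  by apply: (opnorm_dominated_gain l0) => n X; rewrite hBA lexx.
have nmB : norm_minimal B.
  move=> e' e D hD; apply: (nmA _ _ D) => n X c.
  by split=> [/domAB/hD//|/hD/domBA].
have farkas := @cplx_semidefinite_farkas R.
have [I [W [V [hW hV hA]]]] := compression_of_dominated farkas ll0 domBA.
have [J [W' [V' [hW' hV' hB]]]] := compression_of_dominated farkas ll0 domAB.
have hVW k : intertwiner Lt B (V k) (W k).
  exact: (compression_rigid nmA ll0 hW hV hW' hV' hA hB k).
have [V0 [W0 [[hi _] uV uW]]] := unitary_intertwiner nmA ll0 hW hV hA hVW.
have BE j : B j = W0 *m Lt j *m V0^t*.
  by rewrite -hi -mulmxA (mulmx1C uV) mulmx1.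
have higher i (w' : seq 'I_g) : w' != [::] -> f (i :: w') = 0.
  move=> w'0; have [c c0 hc] := wordstep_ball Lt w'.
  pose F : pencil R g l' l := fun j => c ^+ size w' *: f (j :: w').
  (* Contractivity of f bounds D by B in norm, while B is the first block column of D: each is a
     compression of the other, so rigidity applies. *)
  pose D : pencil R g l' (l + l) := fun j => row_mx (B j) (F j).
  have evD n (X : 'I_g -> 'M[Cplx R]_n) (v : 'M[Cplx R]_(l + l, n)) :
      ev D X v = ev B X (usubmx v) + ev F X (dsubmx v).
    rewrite /ev -big_split; apply: eq_bigr => j _ /=.
    by rewrite -{1}[v]vsubmxK mul_row_col mulmxDl.
  have ballD n (X : mxpoint R g n) : pencil_ball Lt X -> opnorm (pencil_eval D X) <= 1.
    move=> /hc hX; rewrite opnorm_gain// => v.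
    rewrite expr1n [ofreal 1]/(1 : Cplx R) mul1r evD -{3}[v]vsubmxK hsnorm_col_mx.
    apply: (higher_order_contraction (usubmx v) (dsubmx v) w'0).
    have [_ hcontr _] := f_ball_map.
    by apply: hcontr; rewrite -hball.
  have domBD : forall n (X : 'I_g -> 'M[Cplx R]_n) c, gain_le B X c -> gain_le D X c.
    by apply: (opnorm_dominated_gain l0) => n X; rewrite hBA; apply: ball_dominated ballD n X.
  have [J' [W1 [V1 [hW1 hV1 hD]]]] := compression_of_dominated farkas ll0 domBD.
  have iso1 : isometries (fun _ : 'I_1 => 1%:M : 'M[Cplx R]_l').
    by rewrite /isometries big_ord1 adjmx1 mulmx1.
  have isoc : isometries (fun _ : 'I_1 => col_mx 1%:M 0 : 'M[Cplx R]_(l + l, l)).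
    rewrite /isometries big_ord1 tr_col_mx map_row_mx mul_row_col adjmx1 mulmx1.
    by rewrite mulmx0 addr0.
  have hBD j : B j = \sum_(k < 1) (1%:M : 'M[Cplx R]_l')^t* *m D j *m col_mx 1%:M 0.
    by rewrite big_ord1 adjmx1 mul1mx mul_row_col mulmx1 mulmx0 addr0.
  (* For the pair (W, V) = (1, [1; 0]) the adjoint relation is D^* = [1; 0] B^*, to be read in its
     lower block. *)
  have [_ /(_ i)] := compression_rigid nmB ll0 iso1 isoc hW1 hV1 hBD hD ord0.
  rewrite mulmx1 mul_col_mx mul1mx mul0mx tr_row_mx map_col_mx => /eq_col_mx[_ F0].
  have : F i = 0 by rewrite -[F i]trmxCK F0 adjmx0.
  by move/eqP; rewrite /F scaler_eq0 expf_eq0 (negbTE c0) andbF /= => /eqP.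
exists W0, V0; split.
- by apply/unitarymxP; apply: mulmx1C.
- by apply/unitarymxP; apply: mulmx1C.
- case=> [|i [|j w]] /=; [exact: fnil|exact: BE|exact: higher].
Qed.
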